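(* (a) A finite dimensional algebra is $1$-complete if and only if it is representation-finite and hereditary. (b) Let $n\ge1$. A finite dimensional algebra $\Lambda$ is absolutely $n$-complete if and only if $\operatorname{gl.dim}\Lambda\le n$ and $\Lambda$ has an absolute $n$-cluster tilting object.
   Context: Conventions: algebras are finite dimensional over a field $k$; modules are finitely generated right modules; $\operatorname{mod}\Lambda$ is the category of such modules; $D=\operatorname{Hom}_k(-,k)$. All subcategories are full and closed under isomorphism, direct sums and direct summands; $\operatorname{add}$ denotes closure under finite direct sums and direct summands. For $\operatorname{gl.dim}\Lambda\le n$ put $\tau_n:=D\operatorname{Ext}^n_\Lambda(-,\Lambda):\operatorname{mod}\Lambda\to\operatorname{mod}\Lambda$. The $\tau_n$-closure of $D\Lambda$ is $\mathcal M=\mathcal M_n(D\Lambda):=\operatorname{add}\{\tau_n^i(D\Lambda)\mid i\ge0\}$. Put $\mathcal P(\mathcal M):=\{X\in\mathcal M\mid \operatorname{pd}X_\Lambda<n\}=\{X\in\mathcal M\mid\tau_nX=0\}$ and $\mathcal M_P:=\{X\in\mathcal M\mid X\text{ has no non-zero direct summands in }\mathcal P(\mathcal M)\}$. A $\Lambda$-module $T$ is tilting if for some $m\ge0$: $\operatorname{pd}T\le m$, $\operatorname{Ext}^i_\Lambda(T,T)=0$ for all $i>0$, and there is an exact sequence $0\to\Lambda\to T_0\to\cdots\to T_m\to0$ with $T_i\in\operatorname{add}T$. Put $T^\perp=\{X\in\operatorname{mod}\Lambda\mid\operatorname{Ext}^i_\Lambda(T,X)=0\ (i>0)\}$. For an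 extension closed subcategory $\mathcal X$ of $\operatorname{mod}\Lambda$, a subcategory $\mathcal C\subseteq\mathcal X$ is $n$-cluster tilting in $\mathcal X$ if it is functorially finite in $\mathcal X$ and $\mathcal C=\{X\in\mathcal X\mid\operatorname{Ext}^i_\Lambda(X,\mathcal C)=0\ (0<i<n)\}=\{X\in\mathcal X\mid\operatorname{Ext}^i_\Lambda(\mathcal C,X)=0\ (0<i<n)\}$. An absolute $n$-cluster tilting object of $\Lambda$ is $C\in\operatorname{mod}\Lambda$ such that $\operatorname{add}C$ is $n$-cluster tilting in $\mathcal X=\operatorname{mod}\Lambda$. $\Lambda$ is $n$-complete if $\operatorname{gl.dim}\Lambda\le n$ and: (A$_n$) there is a tilting $\Lambda$-module $T$ with $\mathcal P(\mathcal M)=\operatorname{add}T$; (B$_n$) $\mathcal M$ is an $n$-cluster tilting subcategory of $T^\perp$; (C$_n$) $\operatorname{Ext}^i_\Lambda(\mathcal M_P,\Lambda)=0$ for all $0<i<n$. It is absolutely $n$-complete if moreover $\mathcal P(\mathcal M)=\operatorname{add}\Lambda$. *)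

(* Defs.v *)
From HB Require Import structures.
From mathcomp Require Import all_boot all_algebra all_field.

Set Implicit Arguments.
Unset Strict Implicit.
Unset Printing Implicit Defensive.

Import GRing.Theory.
Local Open Scope ring_scope.

(* Finite dimensional algebras over a field k are [falgType k]; as for every   *)
(* [nzRingType], 1 != 0 in them.  Over such an algebra the finitely generated  *)
(* modules are exactly those of finite dimension over k, so a module is a      *)
(* [vectType k] with a k-bilinear action.                                      *)

Section Modules.
Variables (k : fieldType) (A : falgType k).

Record rmod := RMod {
  rmod_sort :> vectType k;
  ract : rmod_sort -> A -> rmod_sort;
  ract_linearl : forall a, linear (fun x => ract x a);
  ract_linearr : forall x, linear (ract x);
  ract1 : forall x, ract x 1 = x;
  ractM : forall x a b, ract x (a * b) = ract (ract x a) b }.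

Record lmod := LMod {
  lmod_sort :> vectType k;
  lact : A -> lmod_sort -> lmod_sort;
  lact_linearl : forall x, linear (fun a => lact a x);
  lact_linearr : forall a, linear (lact a);
  lact1 : forall x, lact 1 x = x;
  lactM : forall a b x, lact (a * b) x = lact a (lact b x) }.

Section Actions.
Variables (M : rmod) (L : lmod).

Definition ract_by (a : A) (x : M) : M := ract x a.
HB.instance Definition _ (a : A) :=
  GRing.isLinear.Build k M M *:%R (ract_by a) (@ract_linearl M a).
HB.instance Definition _ (x : M) :=
  GRing.isLinear.Build k A M *:%R (ract x) (@ract_linearr M x).
HB.instance Definition _ (a : A) :=
  GRing.isLinear.Build k L L *:%R (@lact L a) (@lact_linearr L a).

Definition ractf (a : A) : 'End(M) := linfun (ract_by a).
Definition lactf (a : A) : 'End(L) := linfun (@lact L a).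

Lemma ractfE a x : ractf a x = ract x a. Proof. exact: lfunE. Qed.
Lemma lactfE a x : lactf a x = lact a x. Proof. exact: lfunE. Qed.

End Actions.

Definition is_hom (M N : rmod) (f : 'Hom(M, N)) : Prop :=
  forall x a, f (ract x a) = ract (f x) a.

Definition iso (M N : rmod) : Prop :=
  exists2 f : 'Hom(M, N), is_hom f & bijective f.

Definition is_zero (M : rmod) : Prop := forall x : M, x = 0.

Definition homk (M N : rmod) : vectType k := 'Hom(M, N).

Section HomSpace.
Variables M N : rmod.

Definition hom_comm (a : A) (f : 'Hom(M, N)) : 'Hom(M, N) :=
  ((f \o ractf M a) - (ractf N a \o f))%VF.

Fact hom_comm_is_linear a : linear (hom_comm a).
Proof.
move=> c f g; rewrite /hom_comm comp_lfunDl comp_lfunDr -comp_lfunZl -comp_lfunZr.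
by rewrite scalerBr opprD addrACA.
Qed.
HB.instance Definition _ (a : A) :=
  GRing.isLinear.Build k _ _ _ (hom_comm a) (hom_comm_is_linear a).

(* Commuting with the action of a k-basis of A suffices; see [homsP]. *)
Definition homs : {vspace homk M N} :=
  (\bigcap_(a <- vbasis {:A}) lker (linfun (hom_comm a)))%VS.

Lemma homsP (f : 'Hom(M, N)) : reflect (is_hom f) (f \in homs).
Proof.
have memE (s : seq A) : f \in (\bigcap_(a <- s) lker (linfun (hom_comm a)))%VS
  = all (fun a => hom_comm a f == 0) s.
  elim: s => [|a s IHs]; first by rewrite big_nil memvf.
  by rewrite big_cons memv_cap IHs memv_ker lfunE.
rewrite /homs memE; apply: (iffP allP) => [fB x a | fhom a _]; last first.
  by rewrite subr_eq0; apply/eqP/lfunP => x; rewrite !comp_lfunE !ractfE fhom.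
rewrite (coord_vbasis (memvf a)) !linear_sum /=; apply: eq_bigr => i _.
rewrite !linearZ /=; congr (_ *: _).
have /fB : (vbasis {:A})`_i \in vbasis {:A} by rewrite mem_nth // size_tuple.
by rewrite subr_eq0 => /eqP/lfunP/(_ x); rewrite !comp_lfunE !ractfE.
Qed.

End HomSpace.

Lemma is_hom_comp (M N P : rmod) (g : 'Hom(N, P)) (f : 'Hom(M, N)) :
  is_hom g -> is_hom f -> is_hom (g \o f)%VF.
Proof. by move=> gh fh x a; rewrite !comp_lfunE fh gh. Qed.

Fact regular_linl (a : A) : linear (fun x : A => x * a).
Proof. by move=> c x y; rewrite mulrDl scalerAl. Qed.
Fact regular_linr (x : A) : linear (fun a : A => x * a).
Proof. by move=> c a b; rewrite mulrDr scalerAr. Qed.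

Definition regular : rmod :=
  @RMod A (fun x a => x * a) regular_linl regular_linr (@mulr1 A) (@mulrA A).

Fact lregularM (a b x : A) : a * b * x = a * (b * x).
Proof. by rewrite mulrA. Qed.

Definition lregular : lmod :=
  @LMod A (fun a x => a * x) regular_linl regular_linr (@mul1r A) lregularM.

Section ZeroModule.
Definition zero_act (x : 'rV[k]_0) (a : A) : 'rV[k]_0 := x.
Fact zero_linl a : linear (fun x => zero_act x a). Proof. by []. Qed.
Fact zero_linr x : linear (zero_act x).
Proof. by move=> c a b; apply/rowP; case. Qed.
Definition zero_mod : rmod :=
  @RMod 'rV[k]_0 zero_act zero_linl zero_linr
    (fun _ => erefl) (fun _ _ _ => erefl).
End ZeroModule.

Section DirectSum.
Variables M N : rmod.
Definition dsum_act (x : M * N) (a : A) : M * N := (ract x.1 a, ract x.2 a).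
Fact dsum_linl a : linear (fun x => dsum_act x a).
Proof. by move=> c x y; rewrite /dsum_act /= !ract_linearl. Qed.
Fact dsum_linr x : linear (dsum_act x).
Proof. by move=> c a b; rewrite /dsum_act /= !ract_linearr. Qed.
Fact dsum_act1 x : dsum_act x 1 = x.
Proof. by case: x => x y; rewrite /dsum_act /= !ract1. Qed.
Fact dsum_actM x a b : dsum_act x (a * b) = dsum_act (dsum_act x a) b.
Proof. by rewrite /dsum_act /= !ractM. Qed.
Definition dsum : rmod :=
  @RMod (M * N)%type dsum_act dsum_linl dsum_linr dsum_act1 dsum_actM.
End DirectSum.

Section FreeModule.
Variable m : nat.
Definition free_act (x : {ffun 'I_m -> A}) (a : A) : {ffun 'I_m -> A} :=
  [ffun i => x i * a].
Fact free_linl a : linear (fun x => free_act x a).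
Proof. by move=> c x y; apply/ffunP => i; rewrite !ffunE mulrDl scalerAl. Qed.
Fact free_linr x : linear (free_act x).
Proof. by move=> c a b; apply/ffunP => i; rewrite !ffunE mulrDr scalerAr. Qed.
Fact free_act1 x : free_act x 1 = x.
Proof. by apply/ffunP => i; rewrite !ffunE mulr1. Qed.
Fact free_actM x a b : free_act x (a * b) = free_act (free_act x a) b.
Proof. by apply/ffunP => i; rewrite !ffunE mulrA. Qed.
Definition free_mod : rmod :=
  @RMod {ffun 'I_m -> A} free_act free_linl free_linr free_act1 free_actM.
End FreeModule.

Definition stable (M : rmod) (U : {vspace M}) : Prop :=
  forall x a, x \in U -> ract x a \in U.

Section Submodule.
Variables (M : rmod) (U : {vspace M}) (stU : stable U).
Definition sub_act (x : subvs_of U) (a : A) : subvs_of U :=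
  Subvs (stU a (subvsP x)).
Fact sub_linl a : linear (fun x => sub_act x a).
Proof. by move=> c x y; apply/subvs_inj; rewrite /= ract_linearl. Qed.
Fact sub_linr x : linear (sub_act x).
Proof. by move=> c a b; apply/subvs_inj; rewrite /= ract_linearr. Qed.
Fact sub_act1 x : sub_act x 1 = x.
Proof. by apply/subvs_inj; rewrite /= ract1. Qed.
Fact sub_actM x a b : sub_act x (a * b) = sub_act (sub_act x a) b.
Proof. by apply/subvs_inj; rewrite /= ractM. Qed.
Definition submod : rmod :=
  @RMod (subvs_of U) sub_act sub_linl sub_linr sub_act1 sub_actM.

Definition sub_incl : 'Hom(submod, M) := linfun (@vsval k M U).
Lemma sub_inclE x : sub_incl x = vsval x. Proof. exact: lfunE. Qed.
Lemma sub_incl_hom : is_hom sub_incl.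
Proof. by move=> x a; rewrite !sub_inclE. Qed.
Lemma limg_sub_incl : limg sub_incl = U.
Proof.
apply/vspaceP => x; apply/memv_imgP/idP => [[y _ ->]|Ux].
  by rewrite sub_inclE subvsP.
by exists (Subvs Ux); rewrite ?memvf ?sub_inclE.
Qed.
End Submodule.

Section Dual.
Variable L : lmod.
(* D L = Hom_k(L, k) with (phi a)(x) = phi (a x) *)
Definition dual_act (phi : 'Hom(L, k^o)) (a : A) : 'Hom(L, k^o) :=
  (phi \o lactf L a)%VF.
Fact dual_linl a : linear (fun phi => dual_act phi a).
Proof. by move=> c f g; rewrite /dual_act comp_lfunDl comp_lfunZl. Qed.
Fact dual_linr phi : linear (dual_act phi).
Proof.
move=> c a b; apply/lfunP => x.
by rewrite add_lfunE scale_lfunE !comp_lfunE !lactfE lact_linearl linearP.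
Qed.
Fact dual_act1 phi : dual_act phi 1 = phi.
Proof. by apply/lfunP => x; rewrite comp_lfunE lactfE lact1. Qed.
Fact dual_actM phi a b : dual_act phi (a * b) = dual_act (dual_act phi a) b.
Proof. by apply/lfunP => x; rewrite !comp_lfunE !lactfE lactM. Qed.
Definition dual : rmod :=
  @RMod 'Hom(L, k^o) dual_act dual_linl dual_linr dual_act1 dual_actM.
End Dual.

Definition projective (P : rmod) : Prop :=
  forall (M N : rmod) (g : 'Hom(M, N)) (f : 'Hom(P, N)),
    is_hom g -> limg g = fullv -> is_hom f ->
    exists2 h : 'Hom(P, M), is_hom h & f = (g \o h)%VF.

Record proj_res (X : rmod) := ProjRes {
  pr_mod :> nat -> rmod;
  pr_aug : 'Hom(pr_mod 0, X);
  pr_d : forall i, 'Hom(pr_mod i.+1, pr_mod i);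
  pr_projective : forall i, projective (pr_mod i);
  pr_aug_hom : is_hom pr_aug;
  pr_d_hom : forall i, is_hom (pr_d i);
  pr_aug_surj : limg pr_aug = fullv;
  pr_exact0 : limg (pr_d 0) = lker pr_aug;
  pr_exactS : forall i, limg (pr_d i.+1) = lker (pr_d i) }.

Section FreeCover.
Variable M : rmod.
Let m := \dim {:M}.
(* The free module on a k-basis of M, with its canonical epimorphism onto M. *)
Definition cover_fun (x : {ffun 'I_m -> A}) : M :=
  \sum_(i < m) ract (vbasis {:M})`_i (x i).
Fact cover_fun_is_linear : linear cover_fun.
Proof.
move=> c x y; rewrite /cover_fun scaler_sumr -big_split /=.
by apply: eq_bigr => i _; rewrite !ffunE ract_linearr.
Qed.
HB.instance Definition _ :=
  GRing.isLinear.Build k _ _ _ cover_fun cover_fun_is_linear.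
Definition free_cover : 'Hom(free_mod m, M) := linfun cover_fun.
Lemma free_cover_hom : is_hom free_cover.
Proof.
move=> x a; rewrite !lfunE /= /cover_fun -[RHS]/(ract_by a _) linear_sum.
by apply: eq_bigr => i _; rewrite ffunE ractM.
Qed.
Lemma free_cover_surj : limg free_cover = fullv.
Proof.
apply/vspaceP => x; rewrite memvf (coord_vbasis (memvf x)).
apply/memv_imgP; exists [ffun i => (coord (vbasis fullv) i x)%:A].
  by rewrite memvf.
rewrite lfunE /= /cover_fun; apply: eq_bigr => i _.
by rewrite ffunE linearZ /= ract1.
Qed.
End FreeCover.

Lemma free_mod_projective m : projective (free_mod m).
Proof.
move=> M N g f gh gs fh.
pose e i : free_mod m := [ffun j => (i == j)%:R].
have xE (x : free_mod m) : x = \sum_i ract (e i) (x i).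
  apply/ffunP => j; rewrite sum_ffunE (bigD1 j) //= big1 => [|i /negPf ij].
    by rewrite !ffunE eqxx mul1r addr0.
  by rewrite !ffunE ij mul0r.
have [y yE] : exists y : {ffun 'I_m -> M}, forall i, g (y i) = f (e i).
  exists [ffun i => (g^-1)%VF (f (e i))] => i.
  by rewrite ffunE limg_lfunVK // gs memvf.
pose hf (x : {ffun 'I_m -> A}) : M := \sum_i ract (y i) (x i).
have hlin : linear hf.
  move=> c u v; rewrite /hf scaler_sumr -big_split /=.
  by apply: eq_bigr => i _; rewrite !ffunE ract_linearr.
pose hM := GRing.isLinear.Build k {ffun 'I_m -> A} M *:%R hf hlin.
pose hL : {linear {ffun 'I_m -> A} -> M} := HB.pack hf hM.
pose h : 'Hom(free_mod m, M) := linfun hL.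
have hE x : h x = hf x by rewrite lfunE.
exists h.
  move=> x a; rewrite !hE /hf -[RHS]/(ract_by a _) linear_sum.
  by apply: eq_bigr => i _; rewrite ffunE ractM.
apply/lfunP => x; rewrite comp_lfunE hE {1}(xE x) /hf !linear_sum.
by apply: eq_bigr => i _; rewrite [LHS]fh [RHS]gh yE.
Qed.

Lemma lker_stable (M N : rmod) (f : 'Hom(M, N)) : is_hom f -> stable (lker f).
Proof.
move=> fh x a; rewrite !memv_ker fh => /eqP ->.
by rewrite -[ract _ _]/(ract_by a _) linear0.
Qed.

Section FreeResolution.
Variable X : rmod.

Fixpoint syzygy (i : nat) : rmod :=
  if i is j.+1 then submod (lker_stable (@free_cover_hom (syzygy j))) else X.

Definition fres_mod (i : nat) : rmod := free_mod (\dim {:syzygy i}).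

Definition fres_d (i : nat) : 'Hom(fres_mod i.+1, fres_mod i) :=
  (sub_incl (lker_stable (@free_cover_hom (syzygy i)))
     \o free_cover (syzygy i.+1))%VF.

Lemma fres_d_hom i : is_hom (fres_d i).
Proof. by apply: is_hom_comp; [apply: sub_incl_hom | apply: free_cover_hom]. Qed.

Lemma limg_fres_d i : limg (fres_d i) = lker (free_cover (syzygy i)).
Proof. by rewrite limg_comp free_cover_surj limg_sub_incl. Qed.

Lemma lker_fres_d i : lker (fres_d i) = lker (free_cover (syzygy i.+1)).
Proof.
apply/vspaceP => x; rewrite !memv_ker comp_lfunE sub_inclE.
by rewrite -(inj_eq (@subvs_inj _ _ _)).
Qed.

Lemma fres_exactS i : limg (fres_d i.+1) = lker (fres_d i).
Proof. by rewrite limg_fres_d lker_fres_d. Qed.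

Definition free_res : proj_res X :=
  @ProjRes X fres_mod (free_cover X) fres_d (fun i => @free_mod_projective _)
    (@free_cover_hom X) fres_d_hom (free_cover_surj X) (limg_fres_d 0) fres_exactS.

End FreeResolution.

Section ExtOf.
Variables (X : rmod) (P : proj_res X) (Y : rmod).

Definition precomp (i : nat) (f : 'Hom(P i, Y)) : 'Hom(P i.+1, Y) :=
  (f \o pr_d P i)%VF.
Fact precomp_is_linear i : linear (precomp (i := i)).
Proof. by move=> c f g; rewrite /precomp comp_lfunDl comp_lfunZl. Qed.
HB.instance Definition _ i :=
  GRing.isLinear.Build k _ _ _ (precomp (i := i)) (@precomp_is_linear i).
Definition cobd (i : nat) : 'Hom(homk (P i) Y, homk (P i.+1) Y) :=
  linfun (precomp (i := i)).

(* cocycles and coboundaries of the complex Hom_A(P, Y) *)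
Definition Zext (i : nat) : {vspace homk (P i) Y} :=
  (homs (P i) Y :&: lker (cobd i))%VS.
Definition Bext (i : nat) : {vspace homk (P i) Y} :=
  if i is j.+1 then (cobd j @: homs (P j) Y)%VS else 0%VS.

(* The quotient Zext / Bext, realised as a complement of Bext in Zext. *)
Definition ext_of (i : nat) : {vspace homk (P i) Y} := (Zext i :\: Bext i)%VS.

Lemma cobdE i (f : homk (P i) Y) : cobd i f = (f \o pr_d P i)%VF.
Proof. exact: lfunE. Qed.

Lemma Bext_sub i : (Bext i <= Zext i)%VS.
Proof.
case: i => [|i]; first exact: sub0v.
apply/subvP => _ /memv_imgP[f /homsP fh ->]; rewrite memv_cap memv_ker !cobdE.
apply/andP; split; first by apply/homsP/is_hom_comp => //; apply: pr_d_hom.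
apply/eqP/lfunP => x; rewrite !comp_lfunE zero_lfunE.
have : pr_d P i.+1 x \in lker (pr_d P i) by rewrite -pr_exactS memv_img ?memvf.
by rewrite memv_ker => /eqP ->; rewrite linear0.
Qed.

End ExtOf.

Definition Ext (i : nat) (X Y : rmod) := ext_of (free_res X) Y i.

Definition Ext_vanishes (i : nat) (X Y : rmod) : Prop := Ext i X Y = 0%VS.

(* Ext^i(X, A) is a left A-module through the left action of A on its values. *)
Section ExtRegular.
Variables (i : nat) (X : rmod).
Let P := free_res X.
Let Z := Zext P regular i.
Let B := Bext P regular i.
Let E := Ext i X regular.
Let pi : 'End(homk (P i) regular) := addv_pi1 Z B.

Definition lmulh (j : nat) (a : A) (f : 'Hom(P j, regular)) : 'Hom(P j, regular) :=
  (lactf lregular a \o f)%VF.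

Fact lmulhE j a (f : 'Hom(P j, regular)) x : lmulh a f x = a * (f x : A).
Proof. by rewrite comp_lfunE lactfE. Qed.

Fact lmulh_homs j a (f : 'Hom(P j, regular)) :
  f \in homs _ _ -> lmulh a f \in homs _ _.
Proof.
by move=> /homsP fh; apply/homsP => x b; rewrite !lmulhE fh /= mulrA.
Qed.

Fact lmulh_Z a f : f \in Z -> lmulh a f \in Z.
Proof.
rewrite /Z /Zext !memv_cap !memv_ker !cobdE => /andP[fh /eqP f0].
rewrite lmulh_homs //=; apply/eqP/lfunP => x; rewrite comp_lfunE lmulhE.
by move/lfunP: f0 => /(_ x); rewrite comp_lfunE zero_lfunE => ->; rewrite mulr0.
Qed.

Fact lmulh_B a f : f \in B -> lmulh a f \in B.
Proof.
rewrite /B /Bext; case: (i) f => [|j] f.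
  by rewrite !memv0 => /eqP ->; rewrite /lmulh comp_lfun0r.
move=> /memv_imgP[g gh ->]; apply/memv_imgP; exists (lmulh a g); first exact: lmulh_homs.
by rewrite !cobdE; apply: comp_lfunA.
Qed.

Fact pi_B f : f \in B -> pi f = 0.
Proof.
move=> fB; apply/eqP; rewrite -memv0 -(capv_diff Z B) memv_cap.
apply/andP; split; first exact: memv_pi.
have -> : pi f = f - addv_pi2 Z B f.
  by rewrite -{2}(@addv_pi1_pi2 _ _ Z B f) ?addrK // (subvP (addvSr _ _)).
by apply: memvB => //; exact: memv_pi2.
Qed.

Fact pi_modB f : f \in Z -> f - pi f \in B.
Proof.
move=> fZ; rewrite -{1}(@addv_pi1_pi2 _ _ Z B f) ?(subvP (addvSl _ _)) //.
by rewrite addrC addKr; exact: memv_pi2.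
Qed.

Fact E_Z f : f \in E -> f \in Z. Proof. exact/subvP/diffvSl. Qed.

Fact pi_id f : f \in E -> pi f = f.
Proof. exact/daddv_pi_id/capv_diff. Qed.

(* The class of a f, for f the chosen representative of a class in Z / B. *)
Definition ext_act (a : A) (f : subvs_of E) : subvs_of E :=
  Subvs (memv_pi E B (lmulh a (vsval f))).

Fact ext_linl f : linear (fun a => ext_act a f).
Proof.
move=> c a b; apply/subvs_inj.
apply: etrans (linearP pi c (lmulh a (vsval f)) (lmulh b (vsval f))).
congr (pi _); apply/lfunP => x; rewrite add_lfunE scale_lfunE !lmulhE.
by rewrite mulrDl scalerAl.
Qed.
Fact ext_linr a : linear (ext_act a).
Proof.
move=> c f g; apply/subvs_inj.
apply: etrans (linearP pi c (lmulh a (vsval f)) (lmulh a (vsval g))).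
congr (pi _); rewrite /lmulh linearP comp_lfunDr comp_lfunZr.
by [].
Qed.
Fact ext_act1 f : ext_act 1 f = f.
Proof.
apply/subvs_inj => /=.
have -> : lmulh 1 (vsval f) = vsval f by apply/lfunP => x; rewrite lmulhE mul1r.
exact/pi_id/subvsP.
Qed.
Fact ext_actM a b f : ext_act (a * b) f = ext_act a (ext_act b f).
Proof.
apply/subvs_inj; set h := lmulh b (vsval f).
suff: pi (lmulh (a * b) (vsval f)) = pi (lmulh a (pi h)) by [].
apply/eqP; rewrite -subr_eq0 -linearB; apply/eqP/pi_B.
have -> : lmulh (a * b) (vsval f) - lmulh a (pi h) = lmulh a (h - pi h).
  apply/lfunP => x; rewrite lmulhE !add_lfunE !opp_lfunE !lmulhE.
  by rewrite mulrBr mulrA.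
exact/lmulh_B/pi_modB/lmulh_Z/E_Z/subvsP.
Qed.

Definition Ext_regular : lmod :=
  @LMod (subvs_of E) ext_act ext_linl ext_linr ext_act1 ext_actM.
End ExtRegular.

Definition tau (n : nat) (X : rmod) : rmod := dual (Ext_regular n X).

(* pd X < n: some projective resolution of X vanishes in all degrees >= n. *)
Definition pd_lt (X : rmod) (n : nat) : Prop :=
  exists P : proj_res X, forall i, (n <= i)%N -> is_zero (P i).
Definition pd_le (X : rmod) (n : nat) : Prop := pd_lt X n.+1.

Definition gldim_le (n : nat) : Prop := forall X : rmod, pd_le X n.

Definition subcat := rmod -> Prop.

Definition subcat_eq (C C' : subcat) : Prop := forall X, C X <-> C' X.

Definition summand (X Y : rmod) : Prop := exists Z, iso Y (dsum X Z).

Definition add (C : subcat) : subcat := fun X =>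
  exists (m : nat) (F : 'I_m -> rmod),
    (forall i, C (F i)) /\ summand X (\big[dsum/zero_mod]_(i < m) F i).

Definition add1 (T : rmod) : subcat := add (fun X => X = T).

Definition tau_closure (n : nat) : subcat :=
  add (fun X => exists i, X = iter i (tau n) (dual lregular)).

Definition PM (n : nat) : subcat := fun X => tau_closure n X /\ pd_lt X n.

Definition MP (n : nat) : subcat := fun X =>
  tau_closure n X /\ forall Y, summand Y X -> PM n Y -> is_zero Y.

Record coresolution (T : rmod) (m : nat) := Coresolution {
  cr_mod : nat -> rmod;
  cr_coaug : 'Hom(regular, cr_mod 0);
  cr_d : forall i, 'Hom(cr_mod i, cr_mod i.+1);
  cr_add : forall i, (i <= m)%N -> add1 T (cr_mod i);
  cr_zero : forall i, (m < i)%N -> is_zero (cr_mod i);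
  cr_coaug_hom : is_hom cr_coaug;
  cr_d_hom : forall i, is_hom (cr_d i);
  cr_coaug_inj : lker cr_coaug = 0%VS;
  cr_exact0 : limg cr_coaug = lker (cr_d 0);
  cr_exactS : forall i, limg (cr_d i) = lker (cr_d i.+1) }.

Definition tilting (T : rmod) : Prop :=
  exists m : nat,
    [/\ pd_le T m, forall i, (0 < i)%N -> Ext_vanishes i T T
      & inhabited (coresolution T m)].

Definition perp (T : rmod) : subcat := fun X =>
  forall i, (0 < i)%N -> Ext_vanishes i T X.

Definition right_approx (C : subcat) (X : rmod) : Prop :=
  exists (C0 : rmod) (f : 'Hom(C0, X)), [/\ C C0, is_hom f &
    forall (C1 : rmod) (g : 'Hom(C1, X)), C C1 -> is_hom g ->
      exists2 h : 'Hom(C1, C0), is_hom h & g = (f \o h)%VF].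

Definition left_approx (C : subcat) (X : rmod) : Prop :=
  exists (C0 : rmod) (f : 'Hom(X, C0)), [/\ C C0, is_hom f &
    forall (C1 : rmod) (g : 'Hom(X, C1)), C C1 -> is_hom g ->
      exists2 h : 'Hom(C0, C1), is_hom h & g = (h \o f)%VF].

Definition functorially_finite (S C : subcat) : Prop :=
  forall X, S X -> right_approx C X /\ left_approx C X.

Definition cluster_tilting (n : nat) (S C : subcat) : Prop :=
  [/\ functorially_finite S C,
      subcat_eq C (fun X => S X /\
        forall Y i, C Y -> (0 < i < n)%N -> Ext_vanishes i X Y)
    & subcat_eq C (fun X => S X /\
        forall Y i, C Y -> (0 < i < n)%N -> Ext_vanishes i Y X)].

Definition absolute_cluster_tilting (n : nat) (C : rmod) : Prop :=
  cluster_tilting n (fun _ => True) (add1 C).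

Definition n_complete (n : nat) : Prop :=
  [/\ gldim_le n,
      exists T : rmod, [/\ tilting T, subcat_eq (PM n) (add1 T)
                         & cluster_tilting n (perp T) (tau_closure n)]
    & forall X i, MP n X -> (0 < i < n)%N -> Ext_vanishes i X regular].

Definition absolutely_n_complete (n : nat) : Prop :=
  n_complete n /\ subcat_eq (PM n) (add1 regular).

Definition indecomposable (X : rmod) : Prop :=
  ~ is_zero X /\ forall Y Z, iso X (dsum Y Z) -> is_zero Y \/ is_zero Z.

Definition representation_finite : Prop :=
  exists (m : nat) (F : 'I_m -> rmod),
    forall X, indecomposable X -> exists i, iso X (F i).

Definition hereditary : Prop :=
  forall (I : {vspace A}) (stI : stable (M := regular) I), projective (submod stI).

End Modules.

Arguments gldim_le {k} A n.
Arguments n_complete {k} A n.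
Arguments absolutely_n_complete {k} A n.
Arguments representation_finite {k} A.
Arguments hereditary {k} A.

(* Main.v *)
From HB Require Import structures.
From Corelib Require Import Setoid.
From Stdlib Require Import Classical_Prop.
Require Import Defs.
From mathcomp Require Import all_boot all_algebra all_field.

(** Let nu = D Hom(-, A), so that D Hom(P, Y) = Hom(Y, nu P) for P projective.
    Suppose gl.dim A <= n and Ext^i(Z, A) = 0 for 0 < i < n.  Then nu turns a
    projective resolution P_n -> ... -> P_0 of Z into an injective coresolution
    of tau_n Z, so Ext^i(Z, Y) vanishes exactly when Ext^(n-i)(Y, tau_n Z) does.
    Hence an n-cluster tilting subcategory of mod A is closed under tau_n, and,
    reading the same complex from the other end, each of its objects is a direct
    summand of the sum of an injective and tau_n Z for some Z in it.  On such Z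
    the functor tau_n is full, and Hom(DA, tau_n Z) = 0; therefore
    Hom(tau_n^i DA, tau_n^j Y) = 0 for i < j.

    If A lies in add {tau_n^i DA | i < N}, this gives tau_n^N DA = 0, so the
    tau_n-closure of DA has an additive generator.  Conversely let add c be
    n-cluster tilting.  By fullness dim End(tau_n^j c) decreases with j; where it
    is stationary, tau_n is faithful on End(tau_n^j c), so the composites
    tau_n^j c -> A -> tau_n^j c, which tau_n kills, are zero.  As A is a summand
    of a sum of copies of tau_n^i DA (i < j) and tau_n^j c, it has no nonzero map
    to tau_n^j c; thus tau_n^j c = 0 and add c = add {tau_n^i DA | i < j}.

    For n = 1 a cluster tilting object is an additive generator of mod A, which
    exists if and only if A is representation-finite, by Krull-Schmidt. *)

Set Implicit Arguments.
Unset Strict Implicit.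
Unset Printing Implicit Defensive.

Import GRing.Theory.
Local Open Scope ring_scope.

(** * Morphisms of modules *)

Section LinearMaps.
Variable k : fieldType.
Implicit Types V W : vectType k.

(** The statement builds [tau] from chosen free resolutions, which need not be minimal, and gives it
    no action on morphisms. The argument is therefore kept insensitive to projective and injective
    summands: Ext vanishing is reduced to one extension property, [E1], that shifts between the two
    variables; the action of [tau] is a relation, shown to be linear, total and single-valued;
    membership of add C is a factorisation of the identity, so that no summands have to be matched.

    In part (b), P(M) = add A makes the tilting module T projective, so its perpendicular category
    is mod A and only an additive generator of M is wanting. In the other direction T = A serves: an
    object of add c of projective dimension < n is projective, because its Ext groups into A vanish
    in degrees 0 < i < n. Part (a) reduces to (b): for n = 1 projective dimension < n means
    projective, so 1-complete algebras are absolutely 1-complete, and hereditary means gl.dim at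
    most 1. *)

Definition lin_hom V W (f : V -> W) (fL : linear f) : 'Hom(V, W) :=
  let fM := GRing.isLinear.Build k V W *:%R f fL in
  linfun (HB.pack f fM : {linear V -> W}).

Lemma lin_homE V W (f : V -> W) (fL : linear f) x : lin_hom fL x = f x.
Proof. exact: lfunE. Qed.

Lemma lin_form_neq0 V (v : V) : v != 0 -> exists phi : 'Hom(V, k^o), phi v != 0.
Proof.
move=> v0; have [/existsP[i vi]|] := boolP [exists i, coord (vbasis {:V}) i v != 0].
  have cL : linear (coord (vbasis {:V}) i : V -> k^o) by move=> c x y; rewrite linearP.
  by exists (lin_hom cL); rewrite lin_homE.
rewrite negb_exists => /forallP vc; case/eqP: v0.
rewrite (coord_vbasis (memvf v)) big1 // => i _.
by have := vc i; rewrite negbK => /eqP ->; rewrite scale0r.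
Qed.

Lemma lin_form_separates V (U : {vspace V}) (v : V) : v \notin U ->
  exists2 phi : 'Hom(V, k^o), (forall u, u \in U -> phi u = 0) & phi v != 0.
Proof.
move=> vU; have : v - projv U v != 0.
  by apply: contra vU; rewrite subr_eq0 => /eqP ->; apply: memv_proj.
case/lin_form_neq0 => phi phiv; exists (phi \o (\1 - projv U))%VF => [u uU|].
  by rewrite comp_lfunE add_lfunE opp_lfunE id_lfunE projv_id // subrr linear0.
by rewrite comp_lfunE add_lfunE opp_lfunE id_lfunE.
Qed.

Lemma lfun_factor V V' W (p : 'Hom(V, V')) (h : 'Hom(V, W)) :
  (forall x, p x = 0 -> h x = 0) -> exists h' : 'Hom(V', W), forall x, h' (p x) = h x.
Proof.
move=> ph; exists (h \o p^-1)%VF => x; rewrite comp_lfunE.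
apply/eqP; rewrite -subr_eq0 -linearB; apply/eqP/ph.
by rewrite linearB /= limg_lfunVK ?memv_img ?memvf // subrr.
Qed.

Lemma bidual V (F : 'Hom(V, k^o) -> k^o) : linear F ->
  exists v, forall phi, F phi = phi v.
Proof.
move=> FL; pose b := vbasis {:V}.
have cL i : linear (coord b i : V -> k^o) by move=> c x y; rewrite linearP.
exists (\sum_(i < \dim {:V}) (F (lin_hom (cL i)) : k) *: b`_i) => phi.
have phiE : phi = \sum_(i < \dim {:V}) (phi b`_i : k) *: lin_hom (cL i).
  apply/lfunP => v; rewrite sum_lfunE {1}(coord_vbasis (memvf v)) linear_sum /=.
  by apply: eq_bigr => i _; rewrite scale_lfunE lin_homE linearZ /= [LHS]mulrC.
rewrite -[F _](lin_homE FL) {1}phiE !linear_sum /=; apply: eq_bigr => i _.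
by rewrite !linearZ /= lin_homE; exact: mulrC.
Qed.

End LinearMaps.

Section Morphisms.
Variables (k : fieldType) (A : falgType k).
Implicit Types M N X Y Z P : rmod A.

Lemma ractDl M (x y : M) (a : A) : ract (x + y) a = ract x a + ract y a.
Proof. exact: (linearD (ract_by a)). Qed.
Lemma ractNl M (x : M) (a : A) : ract (- x) a = - ract x a.
Proof. exact: (linearN (ract_by a)). Qed.
Lemma ract0l M (a : A) : ract (0 : M) a = 0.
Proof. exact: (linear0 (ract_by a)). Qed.
(** Morphisms are a subtype of the linear maps, so that each hom space becomes a [vectType]; the
    descent on endomorphism rings needs its dimension. *)
Record mor M N : predArgType := Mor { mor_hom : 'Hom(M, N); _ : mor_hom \in homs M N }.

Section MorVect.
Variables M N : rmod A.
HB.instance Definition _ := [isSub of mor M N for @mor_hom M N].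
HB.instance Definition _ := [Choice of mor M N by <:].
HB.instance Definition _ := [SubChoice_isSubZmodule of mor M N by <:].
HB.instance Definition _ := [SubZmodule_isSubLmodule of mor M N by <:].

Fact mor_vect_iso : Vector.axiom (\dim (homs M N)) (mor M N).
Proof.
pose h (f : mor M N) : subvs_of (homs M N) := Subvs (valP f).
have hL : linear h by move=> c f g; apply/val_inj.
have [v vL vB] := @subvs_vect_iso _ _ (homs M N).
exists (v \o h) => [c f g|]; first by rewrite /= hL vL.
apply: bij_comp => //; exists (fun u => Mor (subvsP u)) => u; first exact/val_inj.
exact/subvs_inj.
Qed.
HB.instance Definition _ := Lmodule_hasFinDim.Build k (mor M N) mor_vect_iso.
End MorVect.

Definition mor_fun M N (f : mor M N) (x : M) : N := mor_hom f x.
Coercion mor_fun : mor >-> Funclass.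

Fact mor_fun_is_linear M N (f : mor M N) : linear (mor_fun f).
Proof. by move=> c x y; rewrite /mor_fun linearP. Qed.
HB.instance Definition _ M N (f : mor M N) :=
  GRing.isLinear.Build k M N *:%R (mor_fun f) (mor_fun_is_linear f).

Lemma mor_is_hom M N (f : mor M N) : is_hom (mor_hom f).
Proof. exact/homsP/valP. Qed.
Lemma morA M N (f : mor M N) x a : f (ract x a) = ract (f x) a.
Proof. exact: mor_is_hom. Qed.
Lemma morP M N (f g : mor M N) : (forall x, f x = g x) <-> f = g.
Proof. by split=> [fg|-> //]; apply/val_inj/lfunP. Qed.

Definition mor_of_hom M N (f : 'Hom(M, N)) (fh : is_hom f) : mor M N :=
  Mor (introT (homsP f) fh).
Lemma mor_of_homE M N (f : 'Hom(M, N)) (fh : is_hom f) x : mor_of_hom fh x = f x.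
Proof. by []. Qed.

Fact mk_mor_is_hom M N (f : M -> N) (fL : linear f)
  (fA : forall x a, f (ract x a) = ract (f x) a) : is_hom (lin_hom fL).
Proof. by move=> x a; rewrite !lin_homE. Qed.
Definition mk_mor M N (f : M -> N) (fL : linear f)
  (fA : forall x a, f (ract x a) = ract (f x) a) : mor M N :=
  mor_of_hom (mk_mor_is_hom fL fA).
Lemma mk_morE M N (f : M -> N) fL fA x : @mk_mor M N f fL fA x = f x.
Proof. exact: lin_homE. Qed.

Lemma mor0E M N x : (0 : mor M N) x = 0. Proof. exact: zero_lfunE. Qed.
Lemma morDE M N (f g : mor M N) x : (f + g) x = f x + g x.
Proof. exact: add_lfunE. Qed.
Lemma morNE M N (f : mor M N) x : (- f) x = - f x. Proof. exact: opp_lfunE. Qed.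
Lemma morBE M N (f g : mor M N) x : (f - g) x = f x - g x.
Proof. by rewrite morDE morNE. Qed.
Lemma morZE M N c (f : mor M N) x : (c *: f) x = c *: f x.
Proof. exact: scale_lfunE. Qed.
Lemma mor_sumE M N (I : Type) (r : seq I) (F : I -> mor M N) x :
  (\sum_(i <- r) F i) x = \sum_(i <- r) F i x.
Proof. by elim: r => [|i r IH]; rewrite ?big_nil ?mor0E // !big_cons morDE IH. Qed.

Definition idm M : mor M M := @mk_mor M M id (fun _ _ _ => erefl) (fun _ _ => erefl).
Lemma idmE M x : idm M x = x. Proof. exact: mk_morE. Qed.

Definition compm M N P (g : mor N P) (f : mor M N) : mor M P :=
  mor_of_hom (is_hom_comp (mor_is_hom g) (mor_is_hom f)).
Lemma compmE M N P (g : mor N P) (f : mor M N) x : compm g f x = g (f x).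
Proof. exact: comp_lfunE. Qed.

Local Notation "g '\m' f" := (compm g f) (at level 40, left associativity).

Lemma compmA M N P Q (h : mor P Q) (g : mor N P) (f : mor M N) :
  h \m (g \m f) = h \m g \m f.
Proof. by apply/morP => x; rewrite !compmE. Qed.
Lemma compm1 M N (f : mor M N) : f \m idm M = f.
Proof. by apply/morP => x; rewrite compmE idmE. Qed.
Lemma comp1m M N (f : mor M N) : idm N \m f = f.
Proof. by apply/morP => x; rewrite compmE idmE. Qed.
Lemma compm0 M N P (g : mor N P) : g \m (0 : mor M N) = 0.
Proof. by apply/morP => x; rewrite compmE !mor0E linear0. Qed.
Lemma comp0m M N P (f : mor M N) : (0 : mor N P) \m f = 0.
Proof. by apply/morP => x; rewrite compmE !mor0E. Qed.
Lemma compmDl M N P (g g' : mor N P) (f : mor M N) : (g + g') \m f = g \m f + g' \m f.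
Proof. by apply/morP => x; rewrite compmE !morDE !compmE. Qed.
Lemma compmDr M N P (g : mor N P) (f f' : mor M N) : g \m (f + f') = g \m f + g \m f'.
Proof. by apply/morP => x; rewrite !(compmE, morDE) linearD. Qed.
Lemma compmNl M N P (g : mor N P) (f : mor M N) : (- g) \m f = - (g \m f).
Proof. by apply/morP => x; rewrite !(compmE, morNE). Qed.
Lemma compmNr M N P (g : mor N P) (f : mor M N) : g \m (- f) = - (g \m f).
Proof. by apply/morP => x; rewrite !(compmE, morNE) linearN. Qed.
Lemma compmBl M N P (g g' : mor N P) (f : mor M N) : (g - g') \m f = g \m f - g' \m f.
Proof. by rewrite compmDl compmNl. Qed.
Lemma compmBr M N P (g : mor N P) (f f' : mor M N) : g \m (f - f') = g \m f - g \m f'.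
Proof. by rewrite compmDr compmNr. Qed.
Lemma compmZl M N P c (g : mor N P) (f : mor M N) : (c *: g) \m f = c *: (g \m f).
Proof. by apply/morP => x; rewrite !(compmE, morZE). Qed.
Lemma compmZr M N P c (g : mor N P) (f : mor M N) : g \m (c *: f) = c *: (g \m f).
Proof. by apply/morP => x; rewrite !(compmE, morZE) linearZ. Qed.

Definition inj M N (f : mor M N) := forall x, f x = 0 -> x = 0.
Definition surj M N (f : mor M N) := forall y, exists x, f x = y.
Definition exact M N P (f : mor M N) (g : mor N P) :=
  (forall x, g (f x) = 0) /\ (forall y, g y = 0 -> exists x, f x = y).

Lemma inj_injective M N (f : mor M N) : inj f -> injective f.
Proof.
move=> fi x y fxy; apply/eqP; rewrite -subr_eq0; apply/eqP/fi.
by rewrite linearB /= fxy subrr.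
Qed.

Lemma exact_comp0 M N P (f : mor M N) (g : mor N P) : exact f g -> g \m f = 0.
Proof. by move=> [gf _]; apply/morP => x; rewrite compmE mor0E gf. Qed.

Lemma surj_limg M N (f : mor M N) : surj f <-> limg (mor_hom f) = fullv.
Proof.
split=> [fs|fs y].
  apply/vspaceP => y; rewrite memvf; have [x <-] := fs y.
  by rewrite memv_img ?memvf.
by have := memvf y; rewrite -fs => /memv_imgP[x _ ->]; exists x.
Qed.

Lemma inj_lker M N (f : mor M N) : inj f <-> lker (mor_hom f) = 0%VS.
Proof.
split=> [fi|f0 x fx].
  apply/eqP; rewrite -subv0; apply/subvP => x; rewrite memv_ker => /eqP fx.
  by rewrite memv0; apply/eqP/fi.
by apply/eqP; rewrite -memv0 -f0 memv_ker; apply/eqP.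
Qed.

Lemma exact_limg M N P (f : mor M N) (g : mor N P) :
  exact f g <-> limg (mor_hom f) = lker (mor_hom g).
Proof.
split=> [[gf fg]|fg].
  apply/vspaceP => y; rewrite memv_ker; apply/memv_imgP/eqP => [[x _ ->]|/fg[x <-]].
    exact: gf.
  by exists x; rewrite ?memvf.
split=> [x|y gy].
  apply/eqP; rewrite -[_ == _]memv_ker -fg; exact/memv_img/memvf.
have : y \in lker (mor_hom g) by rewrite memv_ker; apply/eqP.
by rewrite -fg => /memv_imgP[x _ ->]; exists x.
Qed.

Lemma factor_inj M N X (i : mor M N) (h : mor X N) :
  inj i -> (forall x, exists y, i y = h x) -> exists h' : mor X M, h = i \m h'.
Proof.
move=> ii hi; have iV x : i ((mor_hom i)^-1%VF (h x)) = h x.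
  by apply: limg_lfunVK; have [y <-] := hi x; apply/memv_img/memvf.
pose h' x := (mor_hom i)^-1%VF (h x).
have h'L : linear h' by move=> c x y; rewrite /h' !linearP.
have h'A x a : h' (ract x a) = ract (h' x) a.
  by apply: (inj_injective ii); rewrite morA !iV morA.
by exists (mk_mor h'L h'A); apply/morP => x; rewrite compmE mk_morE iV.
Qed.

Lemma factor_surj M N X (p : mor M N) (h : mor M X) :
  surj p -> (forall x, p x = 0 -> h x = 0) -> exists h' : mor N X, h = h' \m p.
Proof.
move=> ps ph; have [h' h'E] := @lfun_factor _ _ _ _ (mor_hom p) (mor_hom h) ph.
have h'h : is_hom h'.
  move=> y a; have [x <-] := ps y.
  rewrite -morA; rewrite [LHS]h'E [in RHS]h'E; exact: morA.
by exists (mor_of_hom h'h); apply/morP => x; rewrite compmE mor_of_homE h'E.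
Qed.

Definition lift_proj P := forall M N (g : mor M N) (f : mor P N),
  surj g -> exists h : mor P M, f = g \m h.

Lemma projectiveP P : projective P <-> lift_proj P.
Proof.
split=> [Pp M N g f gs|Pl M N g f gh gs fh].
  have [h hh gE] := Pp M N (mor_hom g) (mor_hom f) (mor_is_hom g) (proj1 (surj_limg g) gs)
    (mor_is_hom f).
  by exists (mor_of_hom hh); apply/val_inj.
have [|h fE] := Pl M N (mor_of_hom gh) (mor_of_hom fh); first exact/surj_limg.
by exists (mor_hom h); [apply: mor_is_hom | exact: (congr1 (@mor_hom _ _) fE)].
Qed.

End Morphisms.

Local Notation "g '\m' f" := (compm g f) (at level 40, left associativity).

(** * Kernels, quotients, direct sums, retracts and free covers *)

Section Constructions.
Variables (k : fieldType) (A : falgType k).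
Implicit Types M N X Y Z P : rmod A.

Lemma sub_mor_exists M (U : {vspace M}) (stU : stable U) :
  exists i : mor (submod stU) M, inj i /\ forall x, x \in U <-> exists y, i y = x.
Proof.
exists (mor_of_hom (@sub_incl_hom _ _ _ _ stU)); split=> [x|x].
  by rewrite mor_of_homE sub_inclE => x0; apply/subvs_inj.
split=> [xU|[y <-]]; first by exists (Subvs xU); rewrite mor_of_homE sub_inclE.
by rewrite mor_of_homE sub_inclE subvsP.
Qed.

Lemma ker_exists M N (f : mor M N) :
  exists K (i : mor K M), inj i /\ exact i f.
Proof.
have [i [ii iE]] := sub_mor_exists (lker_stable (mor_is_hom f)).
exists _, i; split=> //; split=> [x|y fy].
  by apply/eqP; rewrite -[_ == _]memv_ker; apply/iE; exists x.
by apply/iE; rewrite memv_ker; apply/eqP.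
Qed.

Lemma limg_stable M N (f : 'Hom(M, N)) : is_hom f -> stable (limg f).
Proof. by move=> fh y a /memv_imgP[x _ ->]; rewrite -fh memv_img ?memvf. Qed.

Lemma image_exists M N (f : mor M N) :
  exists I (p : mor M I) (i : mor I N), [/\ surj p, inj i & f = i \m p].
Proof.
have [i [ii iE]] := sub_mor_exists (limg_stable (mor_is_hom f)).
have [x|p fE] := factor_inj (h := f) ii.
  by apply/iE; rewrite memv_img ?memvf.
exists _, p, i; split=> // y.
have /iE/memv_imgP[x _ xE] : exists z, i z = i y by exists y.
by exists x; apply: (inj_injective ii); rewrite -compmE -fE.
Qed.

Section Quotient.
Variables (M : rmod A) (U : {vspace M}) (stU : stable U).

(* The quotient M / U lives on the complement U^C, acted on through projv U^C. *)
Let V := subvs_of (U^C)%VS.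
Let q (x : M) : V := vsproj (U^C)%VS (x - projv U x).

Fact quot_vsval x : vsval (q x) = x - projv U x.
Proof. by rewrite vsprojK // memv_projC. Qed.

Fact quot_linear : linear q.
Proof.
by move=> c x y; apply/subvs_inj; rewrite linearP /= !quot_vsval linearP opprD addrACA scalerBr.
Qed.

Fact quot_eq0 x : q x = 0 <-> x \in U.
Proof.
split=> [qx|xU]; last by apply/subvs_inj; rewrite quot_vsval projv_id ?subrr.
have /eqP := quot_vsval x; rewrite qx /= eq_sym subr_eq0 => /eqP ->; exact: memv_proj.
Qed.

Fact quot_id (x : V) : q (vsval x) = x.
Proof.
apply/subvs_inj; rewrite quot_vsval; suff -> : projv U (vsval x) = 0 by rewrite subr0.
by apply/eqP; rewrite -memv_ker lker_proj subvsP.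
Qed.

Definition quot_act (x : V) (a : A) : V := q (ract (vsval x) a).
Fact quot_linl a : linear (fun x => quot_act x a).
Proof. by move=> c x y; rewrite /quot_act /= ract_linearl quot_linear. Qed.
Fact quot_linr x : linear (quot_act x).
Proof. by move=> c a b; rewrite /quot_act ract_linearr quot_linear. Qed.
Fact quot_act1 x : quot_act x 1 = x.
Proof. by rewrite /quot_act ract1 quot_id. Qed.
Fact quot_actE x a : quot_act (q x) a = q (ract x a).
Proof.
rewrite /quot_act quot_vsval ractDl ractNl addrC -scaleN1r quot_linear scaleN1r.
suff /quot_eq0 -> : ract (projv U x) a \in U by rewrite oppr0 add0r.
exact/stU/memv_proj.
Qed.
Fact quot_actM x a b : quot_act x (a * b) = quot_act (quot_act x a) b.
Proof. by rewrite -{2}[x]quot_id !quot_actE -ractM. Qed.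
Definition quot_mod : rmod A :=
  @RMod k A V quot_act quot_linl quot_linr quot_act1 quot_actM.

Lemma quot_exists : exists Q (p : mor M Q), surj p /\ forall x, p x = 0 <-> x \in U.
Proof.
have qA x a : (q : M -> quot_mod) (ract x a) = ract (q x : quot_mod) a.
  by rewrite -quot_actE.
exists quot_mod, (@mk_mor _ _ M quot_mod q quot_linear qA); split=> [y|x].
  by exists (vsval (y : V)); rewrite mk_morE quot_id.
by rewrite mk_morE; exact: quot_eq0.
Qed.
End Quotient.

Lemma coker_exists M N (f : mor M N) :
  exists Q (p : mor N Q), surj p /\ exact f p.
Proof.
have [Q [p [ps pE]]] := quot_exists (limg_stable (mor_is_hom f)).
exists Q, p; split=> //; split=> [x|y /pE/memv_imgP[x _ ->]]; last by exists x.
by apply/pE; rewrite memv_img ?memvf.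
Qed.

Section Dsum.
Variables M N : rmod A.
Fact dsum_fst_lin : linear (fst : dsum M N -> M). Proof. by []. Qed.
Fact dsum_snd_lin : linear (snd : dsum M N -> N). Proof. by []. Qed.
Definition dfst : mor (dsum M N) M := mk_mor dsum_fst_lin (fun _ _ => erefl).
Definition dsnd : mor (dsum M N) N := mk_mor dsum_snd_lin (fun _ _ => erefl).
Definition dpair_fun X (f : mor X M) (g : mor X N) (x : X) : dsum M N := (f x, g x).
Fact dpair_lin X (f : mor X M) (g : mor X N) : linear (dpair_fun f g).
Proof. by move=> c x y; rewrite /dpair_fun !linearP. Qed.
Fact dpair_act X (f : mor X M) (g : mor X N) x a :
  dpair_fun f g (ract x a) = ract (dpair_fun f g x) a.
Proof. by rewrite /dpair_fun !morA. Qed.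
Definition dpair X (f : mor X M) (g : mor X N) := mk_mor (dpair_lin f g) (dpair_act f g).
Lemma dfstE x : dfst x = x.1. Proof. exact: mk_morE. Qed.
Lemma dsndE x : dsnd x = x.2. Proof. exact: mk_morE. Qed.
Lemma dpairE X (f : mor X M) (g : mor X N) x : dpair f g x = (f x, g x).
Proof. exact: mk_morE. Qed.
Definition dinl : mor M (dsum M N) := dpair (idm M) 0.
Definition dinr : mor N (dsum M N) := dpair 0 (idm N).
Lemma dinlE x : dinl x = (x, 0). Proof. by rewrite dpairE idmE mor0E. Qed.
Lemma dinrE x : dinr x = (0, x). Proof. by rewrite dpairE idmE mor0E. Qed.
Lemma dsum_eta (x : dsum M N) : x = dinl x.1 + dinr x.2.
Proof. by rewrite dinlE dinrE; case: x => x y; congr pair; rewrite /= ?addr0 ?add0r. Qed.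
Lemma dsum_idm : idm (dsum M N) = dinl \m dfst + dinr \m dsnd.
Proof. by apply/morP => x; rewrite idmE morDE !compmE dfstE dsndE -dsum_eta. Qed.
Lemma dfst_inl : dfst \m dinl = idm M.
Proof. by apply/morP => x; rewrite compmE dinlE dfstE idmE. Qed.
Lemma dsnd_inr : dsnd \m dinr = idm N.
Proof. by apply/morP => x; rewrite compmE dinrE dsndE idmE. Qed.
End Dsum.

Lemma is_zero_idm M : is_zero M <-> idm M = 0.
Proof.
split=> [M0|M0 x]; first by apply/morP => x; rewrite (M0 x) !linear0.
by rewrite -[x]idmE M0 mor0E.
Qed.

Lemma iso_of_mor M N (f : mor M N) (g : mor N M) :
  f \m g = idm N -> g \m f = idm M -> iso M N.
Proof.
move=> fg gf; exists (mor_hom f); first exact: mor_is_hom.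
exists (mor_hom g) => x; first by have /morP/(_ x) := gf; rewrite compmE idmE.
by have /morP/(_ x) := fg; rewrite compmE idmE.
Qed.

Lemma isoP M N : iso M N <->
  exists (f : mor M N) (g : mor N M), f \m g = idm N /\ g \m f = idm M.
Proof.
split=> [[f fh fb]|[f [g [fg gf]]]]; last exact: iso_of_mor fg gf.
have fs : surj (mor_of_hom fh) by case: fb => g fK gK y; exists (g y); apply: gK.
have [|g gE] := factor_surj (h := idm M) fs.
  by move=> x /= fx; rewrite idmE; apply: (bij_inj fb); rewrite linear0.
exists (mor_of_hom fh), g; split; last by rewrite gE.
apply/morP => y; have [x <-] := fs y.
by rewrite idmE compmE -[g _]compmE -gE idmE.
Qed.

Lemma retract_split X Y (i : mor X Y) (p : mor Y X) : p \m i = idm X ->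
  exists K (j : mor K Y) (r : mor Y K), idm Y - i \m p = j \m r /\ iso Y (dsum X K).
Proof.
move=> pi; have [K [j [ji [pj jp]]]] := ker_exists p.
have [y|r rE] := factor_inj (h := idm Y - i \m p) ji.
  by apply: jp; rewrite morBE linearB /= idmE compmE -[p (i _)]compmE pi idmE subrr.
have iK x : p (i x) = x by rewrite -compmE pi idmE.
have jr y : j (r y) = y - i (p y) by rewrite -compmE -rE morBE idmE compmE.
exists K, j, r; split=> //.
apply: (@iso_of_mor _ _ (dpair p r) (i \m dfst X K + j \m dsnd X K)).
  apply/morP => -[x z]; rewrite compmE dpairE idmE !(morDE, compmE) dfstE dsndE /=.
  rewrite linearD /= iK pj addr0; congr pair; apply: (inj_injective ji).
  by rewrite jr [p (_ + _)]linearD /= iK pj addr0 addrC addKr.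
apply/morP => y; rewrite compmE dpairE idmE !(morDE, compmE) dfstE dsndE /=.
by rewrite jr addrC subrK.
Qed.

Lemma summandP X Y : summand X Y <->
  exists (i : mor X Y) (p : mor Y X), p \m i = idm X.
Proof.
split=> [[Z /isoP[f [g [fg gf]]]]|[i [p /retract_split[K [_ [_ [_ iK]]]]]]]; last by exists K.
exists (g \m dinl X Z), (dfst X Z \m f).
by rewrite compmA -(compmA _ f) fg compm1 dfst_inl.
Qed.

Lemma lift_proj_free m : lift_proj (free_mod A m).
Proof. exact/projectiveP/free_mod_projective. Qed.

Definition fcover M : mor (free_mod A (\dim {:M})) M := mor_of_hom (@free_cover_hom _ _ M).
Lemma fcover_surj M : surj (fcover M).
Proof. exact/surj_limg/free_cover_surj. Qed.

Definition ses K P W (i : mor K P) (p : mor P W) := [/\ inj i, surj p & exact i p].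

Definition kcover M : mor (syzygy M 1) (free_mod A (\dim {:M})) :=
  mor_of_hom (@sub_incl_hom _ _ _ _ (lker_stable (@free_cover_hom _ _ M))).
Lemma ses_fcover M : ses (kcover M) (fcover M).
Proof.
split; [|exact: fcover_surj|].
  by move=> x; rewrite mor_of_homE sub_inclE => x0; apply/subvs_inj.
by apply/exact_limg; exact: limg_sub_incl.
Qed.

Lemma split_epi_proj P W (p : mor W P) : lift_proj P -> surj p -> exists s, p \m s = idm P.
Proof. by move=> Pp ps; have [s sE] := Pp _ _ p (idm P) ps; exists s. Qed.

End Constructions.

(** * The Nakayama functor *)

Section Nakayama.
Variables (k : fieldType) (A : falgType k).
Implicit Types M N X Y Z P Q : rmod A.
Local Notation "'L'" := (regular A).

Section HomRegular.
Variable X : rmod A.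
Definition lmul_fun (a : A) (f : mor X L) (x : X) : L := a * (f x : A).
Fact lmul_lin a f : linear (lmul_fun a f).
Proof. by move=> c x y; rewrite /lmul_fun linearP mulrDr scalerAr. Qed.
Fact lmul_act a f x b : lmul_fun a f (ract x b) = ract (lmul_fun a f x) b.
Proof. by rewrite /lmul_fun morA /= mulrA. Qed.
Definition lmul a f : mor X L := mk_mor (lmul_lin a f) (lmul_act a f).
Lemma lmulE a f x : lmul a f x = a * (f x : A). Proof. exact: mk_morE. Qed.
Fact hreg_linl f : linear (fun a => lmul a f).
Proof.
move=> c a b; apply/morP => x; rewrite morDE morZE !lmulE.
by rewrite mulrDl scalerAl.
Qed.
Fact hreg_linr a : linear (lmul a).
Proof.
move=> c f g; apply/morP => x; rewrite morDE morZE !lmulE morDE morZE.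
by rewrite mulrDr scalerAr.
Qed.
Fact hreg_act1 f : lmul 1 f = f.
Proof. by apply/morP => x; rewrite lmulE mul1r. Qed.
Fact hreg_actM a b f : lmul (a * b) f = lmul a (lmul b f).
Proof. by apply/morP => x; rewrite !lmulE mulrA. Qed.
Definition hreg : lmod A :=
  @LMod k A (mor X L) lmul hreg_linl hreg_linr hreg_act1 hreg_actM.
End HomRegular.

Definition nu X : rmod A := dual (hreg X).

Definition nuapp X (phi : nu X) (g : mor X L) : k^o := (phi : 'Hom(hreg X, k^o)) g.

Lemma nuappP X (phi psi : nu X) : nuapp phi =1 nuapp psi <-> phi = psi.
Proof. by split=> [pq|-> //]; apply/lfunP. Qed.
Lemma nuapp_linear X (phi : nu X) : linear (nuapp phi).
Proof. by move=> c f g; rewrite /nuapp linearP. Qed.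
HB.instance Definition _ X (phi : nu X) :=
  GRing.isLinear.Build k (mor X L) k^o *:%R (nuapp phi) (@nuapp_linear X phi).
Lemma nuapp0E X g : nuapp (0 : nu X) g = 0. Proof. exact: zero_lfunE. Qed.
Lemma nuappDE X (phi psi : nu X) g : nuapp (phi + psi) g = nuapp phi g + nuapp psi g.
Proof. exact: add_lfunE. Qed.
Lemma nuappBE X (phi psi : nu X) g : nuapp (phi - psi) g = nuapp phi g - nuapp psi g.
Proof. by rewrite [LHS]add_lfunE opp_lfunE. Qed.
Lemma nuappZE X c (phi : nu X) g : nuapp (c *: phi) g = c *: nuapp phi g.
Proof. exact: scale_lfunE. Qed.
Lemma nuapp_act X (phi : nu X) a g : nuapp (ract phi a) g = nuapp phi (lmul a g).
Proof.
rewrite /nuapp /= /dual_act comp_lfunE.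
exact: (congr1 (phi : 'Hom(hreg X, k^o)) (@lactfE _ _ (hreg X) a g)).
Qed.

Definition mk_nu X (h : mor X L -> k^o) (hL : linear h) : nu X := lin_hom hL.
Lemma mk_nuE X h hL g : nuapp (@mk_nu X h hL) g = h g.
Proof. exact: lin_homE. Qed.

Section NuMap.
Variables (X Y : rmod A) (d : mor X Y).
Fact precomp_lin Z : linear (fun g : mor Y Z => g \m d).
Proof. by move=> c f g; rewrite compmDl compmZl. Qed.
Fact nu_fun_lin (phi : nu X) : linear (fun g : mor Y L => nuapp phi (g \m d)).
Proof. by move=> c f g; rewrite precomp_lin linearP. Qed.
Definition nu_fun (phi : nu X) : nu Y := mk_nu (nu_fun_lin phi).
Fact nu_map_lin : linear nu_fun.
Proof. by move=> c f g; apply/nuappP => h; rewrite !(nuappDE, nuappZE, mk_nuE). Qed.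
Fact nu_map_act phi a : nu_fun (ract phi a) = ract (nu_fun phi) a.
Proof.
apply/nuappP => h; rewrite [RHS]nuapp_act [LHS]mk_nuE [RHS]mk_nuE nuapp_act; congr nuapp.
by apply/morP => x; rewrite compmE !lmulE compmE.
Qed.
Definition nu_map : mor (nu X) (nu Y) := mk_mor nu_map_lin nu_map_act.
Lemma nu_mapE phi g : nuapp (nu_map phi) g = nuapp phi (g \m d).
Proof. by rewrite mk_morE mk_nuE. Qed.
End NuMap.

Lemma nu_id X : nu_map (idm X) = idm (nu X).
Proof. by apply/morP => phi; apply/nuappP => g; rewrite nu_mapE compm1 idmE. Qed.
Lemma nu_comp X Y Z (g : mor Y Z) (f : mor X Y) : nu_map (g \m f) = nu_map g \m nu_map f.
Proof. by apply/morP => phi; apply/nuappP => h; rewrite compmE !nu_mapE compmA. Qed.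
Lemma nu_add X Y (f g : mor X Y) : nu_map (f + g) = nu_map f + nu_map g.
Proof.
apply/morP => phi; apply/nuappP => h.
by rewrite morDE nuappDE !nu_mapE compmDr linearD.
Qed.
Lemma nu_sub X Y (f g : mor X Y) : nu_map (f - g) = nu_map f - nu_map g.
Proof.
apply/morP => phi; apply/nuappP => h.
by rewrite morBE nuappBE !nu_mapE compmBr linearB.
Qed.
Lemma nu_zero X Y : nu_map (0 : mor X Y) = 0.
Proof. by apply/morP => phi; apply/nuappP => h; rewrite nu_mapE compm0 mor0E nuapp0E linear0. Qed.

Section RankOne.
Variables (X Y : rmod A).
(** The image of y (x) g under the canonical map from the tensor product of Y and Hom(X, A) over A
    to Hom(X, Y); [rk1_ract] is its balancedness. *)
Definition rk1_fun (y : Y) (g : mor X L) (x : X) : Y := ract y (g x).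
Fact rk1_lin y g : linear (rk1_fun y g).
Proof. by move=> c u v; rewrite /rk1_fun linearP ract_linearr. Qed.
Fact rk1_act y g x a : rk1_fun y g (ract x a) = ract (rk1_fun y g x) a.
Proof. by rewrite /rk1_fun morA -ractM. Qed.
Definition rk1 y g : mor X Y := mk_mor (rk1_lin y g) (rk1_act y g).
Lemma rk1E y g x : rk1 y g x = ract y (g x). Proof. exact: mk_morE. Qed.
Lemma rk1_linl g : linear (rk1^~ g).
Proof. by move=> c u v; apply/morP => x; rewrite morDE morZE !rk1E ract_linearl. Qed.
Lemma rk1_linr y : linear (rk1 y).
Proof. by move=> c u v; apply/morP => x; rewrite morDE morZE !rk1E morDE morZE ract_linearr. Qed.
Lemma rk1_ract y a g : rk1 (ract y a) g = rk1 y (lmul a g).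
Proof. by apply/morP => x; rewrite !rk1E lmulE ractM. Qed.
End RankOne.

(** The [g i] are the coordinates of a section of the free cover, and the [p i] form a [k]-basis of
    [P]. *)
Lemma dual_basis P : lift_proj P ->
  exists (r : nat) (p : 'I_r -> P) (g : 'I_r -> mor P L),
    forall x, x = \sum_i ract (p i) (g i x).
Proof.
move=> Pp; have [s cs] := split_epi_proj Pp (@fcover_surj _ _ P).
pose prj i (x : free_mod A (\dim {:P})) : L := (x : {ffun _ -> A}) i.
have prjL i : linear (prj i) by move=> c x y; rewrite /prj !ffunE.
have prjA i x a : prj i (ract x a) = ract (prj i x) a by rewrite /prj ffunE.
exists _, (fun i => (vbasis {:P})`_i), (fun i => mk_mor (prjL i) (prjA i) \m s) => x.
rewrite -{1}[x]idmE -cs compmE mor_of_homE lfunE /= /cover_fun.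
by apply: eq_bigr => i _; rewrite compmE mk_morE.
Qed.

Lemma dual_basis_mor P r (p : 'I_r -> P) (g : 'I_r -> mor P L) :
  (forall x, x = \sum_i ract (p i) (g i x)) ->
  forall Y (f : mor P Y), f = \sum_i rk1 (f (p i)) (g i).
Proof.
move=> pg Y f; apply/morP => x; rewrite mor_sumE {1}(pg x) linear_sum /=.
by apply: eq_bigr => i _; rewrite rk1E morA.
Qed.

(* An isomorphism D Hom(P, Y) -> Hom(Y, nu P) for P projective: a dual basis of P writes *)
(* every P -> Y as a sum of rank one maps.                                               *)
Section Pairing.
Variables (P Y : rmod A).
Fact pair_nu_lin (psi : 'Hom(mor P Y, k^o)) y : linear (fun g => psi (rk1 y g)).
Proof. by move=> c f g; rewrite rk1_linr linearP. Qed.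
Definition pair_fun (psi : 'Hom(mor P Y, k^o)) (y : Y) : nu P := mk_nu (pair_nu_lin psi y).
Fact pair_lin psi : linear (pair_fun psi).
Proof.
move=> c u v; apply/nuappP => g; rewrite nuappDE nuappZE !mk_nuE.
by rewrite (rk1_linl g) linearP.
Qed.
Fact pair_act psi y a : pair_fun psi (ract y a) = ract (pair_fun psi y) a.
Proof. by apply/nuappP => g; rewrite nuapp_act !mk_nuE rk1_ract. Qed.
Definition pairing psi : mor Y (nu P) := mk_mor (pair_lin psi) (pair_act psi).
Lemma pairingE psi y g : nuapp (pairing psi y) g = psi (rk1 y g).
Proof. by rewrite mk_morE mk_nuE. Qed.

Hypothesis Pp : lift_proj P.

Lemma pairing_inj psi psi' : pairing psi = pairing psi' -> psi = psi'.
Proof.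
move=> /morP pp; have [r [p [g pg]]] := dual_basis Pp.
apply/lfunP => f; rewrite (dual_basis_mor pg f) !linear_sum.
by apply: eq_bigr => i _; have /nuappP/(_ (g i)) := pp (f (p i)); rewrite !pairingE.
Qed.

Lemma pairing_surj (Phi : mor Y (nu P)) : exists psi, Phi = pairing psi.
Proof.
have [r [p [g pg]]] := dual_basis Pp.
(* A trace along the dual basis inverts the pairing. *)
pose h (f : mor P Y) : k^o := \sum_i nuapp (Phi (f (p i))) (g i).
have hL : linear h.
  move=> c u v; rewrite /h scaler_sumr -big_split; apply: eq_bigr => i _.
  by rewrite morDE morZE linearP nuappDE nuappZE.
exists (lin_hom hL); apply/morP => y; apply/nuappP => f; rewrite pairingE lin_homE /h.
rewrite {1}(dual_basis_mor pg f) linear_sum /=; apply: eq_bigr => i _.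
rewrite rk1E morA nuapp_act; congr nuapp.
by apply/morP => x; rewrite rk1E lmulE.
Qed.
End Pairing.

Lemma pairing_nat P Q Y (d : mor P Q) (psi : 'Hom(mor P Y, k^o)) (psi' : 'Hom(mor Q Y, k^o)) :
  (forall h, psi' h = psi (h \m d)) -> nu_map d \m pairing psi = pairing psi'.
Proof.
move=> pp; apply/morP => y; apply/nuappP => g; rewrite compmE nu_mapE !pairingE pp.
by congr (psi _); apply/morP => x; rewrite compmE !rk1E compmE.
Qed.

Lemma pairing_natr P Y Y' (u : mor Y' Y) (psi : 'Hom(mor P Y, k^o)) (psi' : 'Hom(mor P Y', k^o)) :
  (forall h, psi' h = psi (u \m h)) -> pairing psi \m u = pairing psi'.
Proof.
move=> pp; apply/morP => y; apply/nuappP => g; rewrite compmE !pairingE pp.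
by congr (psi _); apply/morP => x; rewrite compmE !rk1E morA.
Qed.

Definition ext_inj I := forall M N (u : mor M N) (v : mor M I), inj u -> exists w, v = w \m u.

(** By the pairing a map [M -> nu P] is a linear form on Hom(P, M). This space embeds in Hom(P, N),
    and linear forms extend from subspaces. *)
Lemma nu_injective P : lift_proj P -> ext_inj (nu P).
Proof.
move=> Pp M N u v ui; have [psi ->] := pairing_surj Pp v.
have postL : linear (fun h : mor P M => u \m h).
  by move=> c f g; rewrite compmDr compmZr.
have [h|psi' psiE] := @lfun_factor _ _ _ _ (lin_hom postL) psi.
  rewrite lin_homE => uh; suff -> : h = 0 by rewrite linear0.
  apply/morP => x; rewrite mor0E; apply: ui; by rewrite -compmE uh mor0E.
exists (pairing psi'); symmetry; apply: pairing_natr => h.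
by rewrite -psiE lin_homE.
Qed.

(* The pairing identifies Hom(Y, nu P) with the dual of the complex Hom(P, Y). *)
Lemma hom_exact_duality P2 P1 P0 (f : mor P2 P1) (g : mor P1 P0) Y :
  lift_proj P2 -> lift_proj P1 -> lift_proj P0 -> g \m f = 0 ->
  (forall h : mor P1 Y, h \m f = 0 -> exists h', h = h' \m g) <->
  (forall h : mor Y (nu P1), nu_map g \m h = 0 -> exists h', h = nu_map f \m h').
Proof.
move=> Pp2 Pp1 Pp0 gf.
pose cf := lin_hom (@precomp_lin _ _ f Y); pose cg := lin_hom (@precomp_lin _ _ g Y).
have cfE h : cf h = h \m f by rewrite /cf lin_homE.
have cgE h : cg h = h \m g by rewrite /cg lin_homE.
split=> [ex Phi|ex h hf].
  have [psi ->] := pairing_surj Pp1 Phi => gPhi.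
  have psig h : psi (h \m g) = 0.
    have := @pairing_nat _ _ _ g psi (psi \o cg)%VF.
    rewrite gPhi => nat0.
    have : pairing (0 : 'Hom(mor P0 Y, k^o)) = pairing (psi \o cg)%VF.
      rewrite -nat0 => [|u]; last by rewrite comp_lfunE cgE.
      by apply/morP => y; apply/nuappP => u; rewrite pairingE zero_lfunE mor0E nuapp0E.
    by move/(pairing_inj Pp0)/lfunP/(_ h); rewrite comp_lfunE zero_lfunE cgE => <-.
  have [h|psi' psiE] := @lfun_factor _ _ _ _ cf psi.
    by rewrite cfE => /ex[h' ->]; apply: psig.
  exists (pairing psi'); symmetry; apply: pairing_nat => h.
  by rewrite -psiE cfE.
(* If [h] were not of the form [h' \m g], some form [psi] would vanish on all of these but not at
   [h]. Its pairing is killed by [nu_map g], hence factors through [nu_map f]; so [psi] depends on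
   [h \m f] only, which is zero. *)
have [/memv_imgP[h' _ hE]|] := boolP (h \in limg cg); first by exists h'; rewrite -cgE.
case/lin_form_separates => psi psi0 /eqP[].
have [|Phi PhiE] := ex (pairing psi).
  rewrite (pairing_nat (psi' := 0)).
    by apply/morP => y; apply/nuappP => u; rewrite pairingE zero_lfunE mor0E nuapp0E.
  by move=> u; rewrite zero_lfunE psi0 // -cgE memv_img ?memvf.
have [psi' Phi'] := pairing_surj Pp2 Phi.
have : pairing psi = pairing (psi' \o cf)%VF.
  by rewrite PhiE Phi'; apply: pairing_nat => u; rewrite comp_lfunE cfE.
by move/(pairing_inj Pp1) => ->; rewrite comp_lfunE cfE hf linear0.
Qed.

(** If [d x] is nonzero, so is some [g i (d x)] for a dual basis of [Q], and a form [phi] detects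
    it. The element [h |-> phi (h x)] of [nu P] then has a nonzero image. *)
Lemma nu_faithful P Q (d : mor P Q) : lift_proj Q -> nu_map d = 0 -> d = 0.
Proof.
move=> Qp d0; have [r [q [g qg]]] := dual_basis Qp.
apply/morP => x; rewrite mor0E (qg (d x)) big1 // => i _.
suff -> : g i (d x) = 0 by rewrite linear0.
apply/eqP/negP => /negP/lin_form_neq0[phi /eqP[]].
have hL : linear (fun h : mor P L => phi (h x)).
  by move=> c u v; rewrite morDE morZE linearP.
have /morP/(_ (mk_nu hL)) := d0; rewrite mor0E => /nuappP/(_ (g i)).
by rewrite nu_mapE mk_nuE nuapp0E compmE.
Qed.

Lemma rk1_lmul X (a : L) (g : mor X L) : rk1 a g = lmul a g.
Proof. by apply/morP => x; rewrite rk1E lmulE. Qed.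

(** By biduality the form [phi |-> nuapp (Phi phi) (g i)] on [nu P] is evaluation at some
    [theta i : P -> A]; a dual basis of [Q] assembles these into [d]. *)
Lemma nu_full P Q (Phi : mor (nu P) (nu Q)) : lift_proj Q -> exists d, Phi = nu_map d.
Proof.
move=> Qp; have [r [q [g qg]]] := dual_basis Qp.
have [theta thetaE] : exists theta : 'I_r -> mor P L,
    forall i phi, nuapp phi (theta i) = nuapp (Phi phi) (g i).
  apply: (@fin_all_exists _ _ (fun i t => forall phi, nuapp phi t = nuapp (Phi phi) (g i))) => i.
  have FL : linear ((fun phi => nuapp (Phi phi) (g i)) : 'Hom(mor P L, k^o) -> k^o).
    by move=> c u v; rewrite linearP nuappDE nuappZE.
  by have [t tE] := bidual FL; exists t => phi; rewrite tE.
exists (\sum_i rk1 (q i) (theta i)); apply/morP => phi; apply/nuappP => h.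
rewrite nu_mapE {1}(dual_basis_mor qg h) linear_sum /=.
have -> : h \m (\sum_i rk1 (q i) (theta i)) = \sum_i lmul (h (q i)) (theta i).
  apply/morP => x; rewrite compmE !mor_sumE linear_sum /=.
  by apply: eq_bigr => i _; rewrite rk1E morA lmulE.
rewrite linear_sum /=; apply: eq_bigr => i _.
by rewrite rk1_lmul -[LHS]nuapp_act -[RHS]nuapp_act thetaE morA.
Qed.

Definition dualreg : rmod A := dual (lregular A).

Lemma iso_dualreg : iso dualreg (nu L).
Proof.
pose one : L := 1 : A.
have gE (g : mor L L) (a : L) : g a = (g one : A) * a by rewrite -{1}[a]mul1r; exact: morA.
have f1L (phi : dualreg) : linear (fun g : mor L L => (phi : 'Hom(A, k^o)) (g one)).
  by move=> c u v; rewrite morDE morZE linearP.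
have fL : linear ((fun phi => mk_nu (f1L phi)) : dualreg -> nu L).
  move=> c u v; apply/nuappP => g; rewrite nuappDE nuappZE !mk_nuE.
  by rewrite add_lfunE scale_lfunE.
have fA (phi : dualreg) a : mk_nu (f1L (ract phi a)) = ract (mk_nu (f1L phi) : nu L) a.
  apply/nuappP => g; rewrite [RHS]nuapp_act [LHS]mk_nuE [RHS]mk_nuE lmulE [LHS]comp_lfunE.
  exact: congr1 (@lactfE _ _ (lregular A) a (g one)).
have g1L (psi : nu L) : linear ((fun a => nuapp psi (lmul a (idm L))) : A -> k^o).
  by move=> c u v; rewrite (@hreg_linl L (idm L)) linearP.
have gL : linear ((fun psi => lin_hom (g1L psi)) : nu L -> dualreg).
  move=> c u v; apply/lfunP => a; rewrite add_lfunE scale_lfunE !lin_homE.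
  by rewrite nuappDE nuappZE.
have gA (psi : nu L) a : lin_hom (g1L (ract psi a)) = ract (lin_hom (g1L psi) : dualreg) a.
  apply/lfunP => b; rewrite [LHS]lin_homE nuapp_act -hreg_actM.
  rewrite [RHS]comp_lfunE [X in _ = fun_of_lfun _ X](@lactfE _ _ (lregular A) a b).
  by rewrite [RHS]lin_homE.
apply: (@iso_of_mor _ _ _ _ (mk_mor fL fA) (mk_mor gL gA)); apply/morP => phi.
  apply/nuappP => g; rewrite compmE idmE !mk_morE mk_nuE lin_homE; congr nuapp.
  by apply/morP => x; rewrite lmulE idmE -gE.
apply/lfunP => a; rewrite compmE idmE !mk_morE lin_homE mk_nuE lmulE idmE.
by rewrite mulr1.
Qed.

(** Enough injectives. [P] is free on a basis of [Y] and [psi] is a trace form on Hom(P, Y): the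
    image of [y], evaluated at the [i]-th projection of [P], is the [i]-th coordinate of [y]. *)
Lemma embed_nu Y : exists P, lift_proj P /\ exists i : mor Y (nu P), inj i.
Proof.
pose m := \dim {:Y}; pose P := free_mod A m; pose b := vbasis {:Y}.
pose e (i : 'I_m) : P := [ffun j => (i == j)%:R].
pose prj i (x : P) : L := (x : {ffun _ -> A}) i.
have prjL i : linear (prj i) by move=> c x y; rewrite /prj !ffunE.
have prjA i x a : prj i (ract x a) = ract (prj i x) a by rewrite /prj ffunE.
pose psi (h : mor P Y) : k^o := \sum_i coord b i (h (e i)).
have psiL : linear psi.
  move=> c u v; rewrite /psi scaler_sumr -big_split; apply: eq_bigr => i _.
  by rewrite morDE morZE linearP.
exists P; split; first exact: lift_proj_free.
exists (pairing (lin_hom psiL)) => y y0.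
rewrite (coord_vbasis (memvf y)) big1 // => i _.
have /nuappP/(_ (mk_mor (prjL i) (prjA i))) := y0.
rewrite pairingE nuapp0E lin_homE /psi (bigD1 i) //= big1 => [|j /negPf ji].
  rewrite addr0 rk1E mk_morE /prj ffunE eqxx ract1 => ->; exact: scale0r.
by rewrite rk1E mk_morE /prj ffunE ji (linear0 (ract _)) linear0.
Qed.

End Nakayama.

(** * Vanishing of Ext *)

Section ExtTheory.
Variables (k : fieldType) (A : falgType k).
Implicit Types M N X Y Z P Q W K L I S : rmod A.

Lemma inj_cancel M N X (a : mor M N) (f g : mor X M) : inj a -> a \m f = a \m g -> f = g.
Proof.
move=> ai /morP fg; apply/morP => x; apply: (inj_injective ai).
by have := fg x; rewrite !compmE.
Qed.

Lemma surj_cancel M N X (p : mor M N) (f g : mor N X) : surj p -> f \m p = g \m p -> f = g.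
Proof.
move=> ps /morP fg; apply/morP => y; have [x <-] := ps y.
by have := fg x; rewrite !compmE.
Qed.

Lemma factor_ker M N P X (i : mor M N) (p : mor N P) (f : mor X N) :
  inj i -> exact i p -> p \m f = 0 -> exists f', f = i \m f'.
Proof.
move=> ii [_ ex] /morP pf; apply: factor_inj => // x; apply: ex.
by have := pf x; rewrite compmE mor0E.
Qed.

Lemma factor_coker M N P X (i : mor M N) (p : mor N P) (f : mor N X) :
  surj p -> exact i p -> f \m i = 0 -> exists f', f = f' \m p.
Proof.
move=> ps [_ ex] /morP fi; apply: factor_surj => // x /ex[y <-].
by have := fi y; rewrite compmE mor0E.
Qed.

Lemma ses_split K P W (i : mor K P) (p : mor P W) (r : mor P K) :
  ses i p -> r \m i = idm K -> exists s, p \m s = idm W.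
Proof.
move=> [ii ps ex] ri; have [|s sE] := @factor_coker _ _ _ _ i p (idm P - i \m r) ps ex.
  by rewrite compmBl comp1m -compmA ri compm1 subrr.
exists s; apply: (surj_cancel ps); rewrite -compmA -sE compmBr compm1 compmA.
by rewrite (exact_comp0 ex) comp0m subr0 comp1m.
Qed.

Lemma lift_proj_retract P W (p : mor P W) (s : mor W P) :
  p \m s = idm W -> lift_proj P -> lift_proj W.
Proof.
move=> ps Pp M N g f gs; have [h hE] := Pp _ _ g (f \m p) gs.
by exists (h \m s); rewrite compmA -hE -compmA ps compm1.
Qed.

Lemma ext_inj_retract I Y (p : mor I Y) (s : mor Y I) :
  p \m s = idm Y -> ext_inj I -> ext_inj Y.
Proof.
move=> ps Ip M N u v ui; have [w wE] := Ip _ _ u (s \m v) ui.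
by exists (p \m w); rewrite -compmA -wE compmA ps comp1m.
Qed.

Lemma lift_proj_zero P : is_zero P -> lift_proj P.
Proof.
move=> P0 M N g f _; exists 0; apply/morP => x.
by rewrite (P0 x) !linear0.
Qed.

(* Ext^1(W, Y) = 0, as an extension property along all presentations of W. *)
Definition E1 W Y := forall K P (i : mor K P) (p : mor P W),
  ses i p -> forall h : mor K Y, exists h', h = h' \m i.

Lemma E1_proj K P W (i : mor K P) (p : mor P W) Y : ses i p -> lift_proj P ->
  E1 W Y <-> forall h : mor K Y, exists h', h = h' \m i.
Proof.
move=> sip Pp; split=> [E|E K' E' j q [ij qs ejq] h]; first exact: E sip.
have [ii ps ex] := sip; have [u uE] := Pp _ _ q p qs.
have [|v vE] := @factor_ker _ _ _ _ j q (u \m i) ij ejq.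
  by rewrite compmA -uE (exact_comp0 ex).
have [g gE] := E (h \m v).
(* [E'] is the pushout of [i] and [v]: [s] is onto and [t] kills its kernel, so [h] extends over
   [E']. *)
pose s := j \m dfst K' P + u \m dsnd K' P; pose t := h \m dfst K' P + g \m dsnd K' P.
have sE y x : s (y, x) = j y + u x by rewrite morDE !compmE dfstE dsndE.
have tE y x : t (y, x) = h y + g x by rewrite morDE !compmE dfstE dsndE.
have ss : surj s.
  move=> e; have [x xE] := ps (q e); case: (ejq) => _ /(_ (e - u x)) [|y yE].
    by rewrite linearB /= -xE uE compmE subrr.
  by exists (y, x); rewrite sE yE subrK.
have [|h' h'E] := factor_surj (h := t) ss.
  move=> [y x]; rewrite sE tE => yx.
  have px : p x = 0.
    have := congr1 q yx; rewrite linearD linear0 /= uE compmE.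
    by case: (ejq) => -> _; rewrite add0r.
  case: ex => _ /(_ x px)[z zE].
  have -> : y = - v z.
    apply: (inj_injective ij); rewrite linearN /= -[j (v z)]compmE -vE compmE zE.
    by apply/eqP; rewrite -addr_eq0 yx.
  by rewrite linearN /= -[h (v z)]compmE gE compmE zE addNr.
exists h'; apply/morP => y.
have /morP/(_ (y, 0)) := h'E; rewrite compmE tE sE !linear0 !addr0 => ->.
by rewrite compmE.
Qed.

(** Ext^1 is read from an injective copresentation of [Y] instead. Having both descriptions allows
    dimension shifting in either variable. *)
Lemma E1_inj Y I S (a : mor Y I) (q : mor I S) W : ses a q -> ext_inj I ->
  E1 W Y <-> forall g : mor W S, exists g', g = q \m g'.
Proof.
move=> [ai qs ex] Ii; split=> [E g|E K P i p [ii ps eip] h].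
  have Fp := @lift_proj_free _ A (\dim {:W}).
  have sc := ses_fcover W; have [ci cs cex] := sc.
  have [l lE] := Fp _ _ q (g \m fcover W) qs.
  have [|v vE] := @factor_ker _ _ _ _ a q (l \m kcover W) ai ex.
    by rewrite compmA -lE -compmA (exact_comp0 cex) compm0.
  have [v' v'E] := E _ _ _ _ sc v.
  have [|g' g'E] := @factor_coker _ _ _ _ (kcover W) (fcover W) (l - a \m v') cs cex.
    by rewrite compmBl vE -compmA v'E subrr.
  exists g'; apply: (surj_cancel cs); rewrite -compmA -g'E compmBr -lE compmA.
  by rewrite (exact_comp0 ex) comp0m subr0.
have [l lE] := Ii _ _ i (a \m h) ii.
have [|g gE] := @factor_coker _ _ _ _ i p (q \m l) ps eip.
  by rewrite -compmA -lE compmA (exact_comp0 ex) comp0m.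
have [g' g'E] := E g.
have [|h' h'E] := @factor_ker _ _ _ _ a q (l - g' \m p) ai ex.
  by rewrite compmBr gE g'E compmA subrr.
exists h'; apply: (inj_cancel ai); rewrite compmA -h'E compmBl -lE -compmA.
by rewrite (exact_comp0 eip) compm0 subr0.
Qed.

(** Both conditions concern maps [L -> S]: the first says that they lift to [I], the second that
    they extend to [P]. Each implies the other because [I] is injective and [P] projective. *)
Lemma E1_shift L P K Y I S (i : mor L P) (p : mor P K) (a : mor Y I) (q : mor I S) :
  ses i p -> lift_proj P -> ses a q -> ext_inj I -> E1 L Y <-> E1 K S.
Proof.
move=> sip Pp saq Ii; have [ii _ _] := sip; have [_ qs _] := saq.
rewrite (E1_inj _ saq Ii) (E1_proj _ sip Pp); split=> E g.
  have [g' ->] := E g; have [l ->] := Ii _ _ i g' ii.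
  by exists (q \m l); rewrite compmA.
have [h ->] := E g; have [l ->] := Pp _ _ q h qs.
by exists (l \m i); rewrite compmA.
Qed.

Lemma E1_injective W I : ext_inj I -> E1 W I.
Proof. by move=> Ii K P i p [ii _ _] h; apply: Ii. Qed.

Lemma E1_projective P Y : lift_proj P -> E1 P Y.
Proof.
move=> Pp K E i p sip h; have [ii ps ex] := sip.
have [s sE] := split_epi_proj Pp ps.
have [|r rE] := @factor_ker _ _ _ _ i p (idm E - s \m p) ii ex.
  by rewrite compmBr compmA sE comp1m compm1 subrr.
exists (h \m r); rewrite -compmA; suff -> : r \m i = idm K by rewrite compm1.
apply: (inj_cancel ii); rewrite compmA -rE compmBl -compmA (exact_comp0 ex) compm0.
by rewrite subr0 comp1m compm1.
Qed.

Lemma E1_lift_proj P : (forall Y, E1 P Y) -> lift_proj P.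
Proof.
move=> E; have sc := ses_fcover P; have [r rE] := E _ _ _ _ _ sc (idm _).
have [s sE] := ses_split sc (esym rE).
exact: lift_proj_retract sE (@lift_proj_free _ _ _).
Qed.

Lemma E1_regular W Q : lift_proj Q -> E1 W (regular A) -> E1 W Q.
Proof.
move=> /dual_basis[r [q [g qg]]] E K P i p sip h.
have [t tE] : exists t : 'I_r -> mor P (regular A), forall j, g j \m h = t j \m i.
  by apply: (@fin_all_exists _ _ (fun j t => g j \m h = t \m i)) => j; apply: E sip _.
exists (\sum_j rk1 (q j) (t j)); apply/morP => x; rewrite compmE mor_sumE.
rewrite {1}(qg (h x)); apply: eq_bigr => j _; rewrite rk1E.
by congr (ract _ _); have /morP/(_ x) := tE j; rewrite !compmE.
Qed.

Definition res_d X (P : proj_res X) i : mor (P i.+1) (P i) :=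
  mor_of_hom (@pr_d_hom _ _ _ P i).

Lemma ext_of_eq0P X (P : proj_res X) Y i :
  ext_of P Y i.+1 = 0%VS <->
  forall f : mor (P i.+1) Y, f \m res_d P i.+1 = 0 ->
    exists g : mor (P i) Y, f = g \m res_d P i.
Proof.
have cE j (f : mor (P j) Y) : cobd P Y j (mor_hom f) = mor_hom (f \m res_d P j).
  exact: cobdE.
have -> : ext_of P Y i.+1 = 0%VS <-> (Zext P Y i.+1 <= Bext P Y i.+1)%VS.
  by rewrite -diffv_eq0; split=> [/eqP|/eqP].
split=> [/subvP ZB f f0|E].
  have /ZB/memv_imgP[g /homsP gh fE] : mor_hom f \in Zext P Y i.+1.
    apply/memv_capP; split; first exact: valP.
    by rewrite memv_ker; apply/eqP; rewrite cE f0.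
  exists (mor_of_hom gh); apply/val_inj; rewrite /= -[LHS]/(mor_hom f) fE.
  exact: (cE _ (mor_of_hom gh)).
apply/subvP => f /memv_capP[/homsP fh]; rewrite memv_ker => /eqP f0.
have [|g gE] := E (mor_of_hom fh); first by apply/val_inj; rewrite -[LHS]cE.
apply/memv_imgP; exists (mor_hom g); first exact: valP.
by rewrite cE -gE.
Qed.

(** Cocycles of degree i+1 are the maps out of the (i+1)-st syzygy, and coboundaries are those that
    extend to the free module covering the [i]-th. *)
Lemma ext_vanishesP i X Y : Ext_vanishes i.+1 X Y <-> E1 (syzygy X i) Y.
Proof.
have dE j : res_d (free_res X) j = kcover (syzygy X j) \m fcover (syzygy X j.+1).
  exact/val_inj.
have [_ cs ex] := ses_fcover (syzygy X i.+1).
have [_ cs' _] := ses_fcover (syzygy X i.+2).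
rewrite (E1_proj _ (ses_fcover (syzygy X i)) (@lift_proj_free _ _ _)) [X in X <-> _]ext_of_eq0P.
rewrite !dE; split=> E => [h|f].
  have [|g] := E (h \m fcover (syzygy X i.+1)).
    by rewrite compmA -(compmA h) (exact_comp0 ex) compm0 comp0m.
  by rewrite compmA => /(surj_cancel cs) gE; exists g.
rewrite compmA -[RHS](comp0m _ (fcover _)) => /(surj_cancel cs') f0.
have [h ->] := factor_coker cs ex f0.
by have [g ->] := E h; exists g; rewrite compmA.
Qed.

(** A relation, because the syzygies met later come from arbitrary projective complexes and not only
    from [free_res]; [cosyz] is the injective counterpart. *)
Fixpoint syz W j L : Prop :=
  if j is j'.+1 then exists K P (i : mor L P) (p : mor P K),
    [/\ syz W j' K, lift_proj P & ses i p]
  else L = W.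

Fixpoint cosyz j Y S : Prop :=
  if j is j'.+1 then exists I Y' (a : mor Y I) (q : mor I Y'),
    [/\ ext_inj I, ses a q & cosyz j' Y' S]
  else S = Y.

Lemma cosyzS j Y K I S (a : mor K I) (q : mor I S) :
  cosyz j Y K -> ext_inj I -> ses a q -> cosyz j.+1 Y S.
Proof.
move=> + Ii saq; elim: j Y => [|j IH] Y /= => [YK|[J [Y' [b [r [Ji sbr c]]]]]].
  by subst K; exists I, S, a, q.
by exists J, Y', b, r; split=> //; apply: IH.
Qed.

Lemma cosyz_exists j Y : exists S, cosyz j Y S.
Proof.
elim: j => [|j [S cS]]; first by exists Y.
have [P [Pp [a ai]]] := embed_nu S; have [Q [q [qs ex]]] := coker_exists a.
by exists Q; have saq : ses a q by []; exact: cosyzS cS (nu_injective Pp) saq.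
Qed.

Lemma E1_syz_cosyz j W K Y S : syz W j K -> cosyz j Y S -> E1 K Y <-> E1 W S.
Proof.
elim: j K Y => [|j IH] K Y /= => [-> ->//|].
move=> [K' [P [i [p [sK Pp sip]]]]] [I [Y' [a [q [Ii saq cS]]]]].
by rewrite (E1_shift sip Pp saq Ii); apply: IH.
Qed.

Lemma syz_syzygy j X : syz X j (syzygy X j).
Proof.
elim: j => [//|j IH]; exists (syzygy X j), (free_mod A (\dim {:syzygy X j})).
exists (kcover _), (fcover _); split=> //; first exact: lift_proj_free.
exact: ses_fcover.
Qed.

Lemma ext_cosyz j X Y S : cosyz j Y S -> Ext_vanishes j.+1 X Y <-> E1 X S.
Proof. by move=> c; rewrite ext_vanishesP; apply: E1_syz_cosyz c; apply: syz_syzygy. Qed.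

(** Independence of the resolution without comparing resolutions: both sides are [E1 X S] for one
    [j]-th cosyzygy [S] of [Y]. *)
Lemma ext_syz j X Y K : syz X j K -> Ext_vanishes j.+1 X Y <-> E1 K Y.
Proof.
move=> sK; have [S cS] := cosyz_exists j Y.
by rewrite (ext_cosyz _ cS) (E1_syz_cosyz sK cS).
Qed.

Lemma ext_projective i P Y : lift_proj P -> (0 < i)%N -> Ext_vanishes i P Y.
Proof.
case: i => // i Pp _; have [S cS] := cosyz_exists i Y.
by rewrite (ext_cosyz _ cS); apply: E1_projective.
Qed.

Lemma ext_injective i X I : ext_inj I -> (0 < i)%N -> Ext_vanishes i X I.
Proof. by case: i => // i Ii _; rewrite ext_vanishesP; apply: E1_injective. Qed.

Lemma res_syz X (P : proj_res X) j : exists K (p : mor (P j) K),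
  [/\ surj p, exact (res_d P j) p & syz X j K].
Proof.
elim: j => [|j [K [p [ps ex sK]]]].
  exists X, (mor_of_hom (@pr_aug_hom _ _ _ P)); split=> //; first exact/surj_limg/pr_aug_surj.
  exact/exact_limg/pr_exact0.
have [I [q [i [qs ii iq]]]] := image_exists (res_d P j).
exists I, q; split=> //.
  have [d0 d1] : exact (res_d P j.+1) (res_d P j).
    exact/exact_limg/pr_exactS.
  split=> [x|y qy].
    by apply: (inj_injective ii); rewrite linear0 -compmE -iq.
  by apply: d1; rewrite iq compmE qy linear0.
exists K, (P j), i, p; split=> //; first exact/projectiveP/pr_projective.
split=> //; case: ex => e0 e1; split=> [x|y /e1[x <-]].
  by have [y <-] := qs x; rewrite -[i _]compmE -iq e0.
by exists (q x); rewrite iq compmE.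
Qed.

Lemma pd_lt_syz X n : pd_lt X n.+1 -> exists2 K, syz X n K & lift_proj K.
Proof.
move=> [P Pz]; have [K [p [ps [_ ex] sK]]] := res_syz P n.
(* [P n.+1] is zero, so [p : P n -> K] is bijective. *)
exists K => //; have [|r rE] := factor_surj (h := idm _) ps.
  by move=> y /ex[x <-]; rewrite (Pz _ (leqnn _) x) !linear0.
apply: (@lift_proj_retract (P n) K p r); last exact/projectiveP/pr_projective.
by apply: (surj_cancel ps); rewrite -compmA -rE compm1 comp1m.
Qed.

Lemma gldim_syz n X L : gldim_le A n -> syz X n L -> lift_proj L.
Proof.
move=> /(_ X)/pd_lt_syz[K sK Kp] sL; apply: E1_lift_proj => Y.
by rewrite -(ext_syz _ sL) (ext_syz _ sK); apply: E1_projective.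
Qed.

(* A finite projective resolution splits at its last term Q when the top Ext(X, Q) *)
(* vanishes, and Q is a summand of a power of A.                                   *)
Lemma pd_lt_projective n X : pd_lt X n.+1 ->
  (forall i, (0 < i < n.+1)%N -> Ext_vanishes i X (regular A)) -> lift_proj X.
Proof.
move=> /pd_lt_syz[K sK Kp]; elim: n K sK Kp => [|n IH] L; first by move=> /= ->.
move=> [K [P [i [p [sK Pp sip]]]]] Lp ext0; apply: (IH K sK) => [|j /andP[j0 jn]]; last first.
  by apply: ext0; rewrite j0 ltnW.
have /(ext_syz _ sK)/(E1_regular Lp) E : Ext_vanishes n.+1 X (regular A).
  by apply: ext0; rewrite ltnS leqnn.
have [r rE] := E _ _ _ _ sip (idm _); have [s sE] := ses_split sip (esym rE).
exact: lift_proj_retract sE Pp.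
Qed.

End ExtTheory.

(** * The translate as a kernel *)

Section TauKernel.
Variables (k : fieldType) (A : falgType k) (Z : rmod A) (m : nat).
Local Notation "'L'" := (regular A).
Let P := free_res Z.
Let n := m.+1.
Let ZZ := Zext P L n.
Let B := Bext P L n.
Let E := Ext n Z L.
Let W := syzygy Z n.
Let inc : mor W (P m) := kcover (syzygy Z m).

Let cls (f : homk (P n) L) : subvs_of E := Subvs (memv_pi E B f).
Let infl (g : mor W L) : homk (P n) L := mor_hom (g \m fcover W).

Let cls_lin : linear cls.
Proof. by move=> c f g; apply/subvs_inj; exact: linearP. Qed.

Let infl_lin : linear infl.
Proof. by move=> c f g; rewrite /infl compmDl compmZl. Qed.

Let inflZ g : infl g \in ZZ.
Proof.
apply/memv_capP; split; first exact: valP.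
have [_ _ ex] := ses_fcover W.
rewrite memv_ker cobdE; apply/eqP/lfunP => x.
have : g \m fcover W \m res_d P n = 0.
  have -> : res_d P n = kcover W \m fcover (syzygy Z n.+1) by exact/val_inj.
  by rewrite -compmA (compmA (fcover W)) (exact_comp0 ex) comp0m compm0.
by move/morP/(_ x).
Qed.

Let infl_surj f : f \in ZZ -> exists g, f = infl g.
Proof.
move=> /memv_capP[/homsP fh]; rewrite memv_ker => /eqP f0.
have [_ cs ex] := ses_fcover W; have [_ cs' _] := ses_fcover (syzygy Z n.+1).
have [|g gE] := @factor_coker _ _ _ _ _ _ _ _ (mor_of_hom fh) cs ex.
  apply: (surj_cancel cs'); rewrite comp0m -compmA; apply/val_inj.
  exact: etrans (esym (cobdE _)) f0.
by exists g; rewrite /infl -gE.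
Qed.

Let infl_inj g g' : infl g = infl g' -> g = g'.
Proof. by have [_ cs _] := ses_fcover W => gg; apply: (surj_cancel cs); apply/val_inj. Qed.

Let BP f : f \in B <-> exists h : mor (P m) L, f = infl (h \m inc).
Proof.
have cE (h : mor (P m) L) : cobd P L m (mor_hom h) = infl (h \m inc).
  by rewrite [LHS]cobdE /infl -compmA.
split=> [/memv_imgP[h /homsP hh ->]|[h ->]]; first by exists (mor_of_hom hh); rewrite -cE.
by rewrite -cE memv_img //; exact: valP.
Qed.

Let cls_act a f : f \in ZZ -> cls (lmulh a (vsval (cls f))) = cls (lmulh a f).
Proof.
move=> fZ; apply/subvs_inj/eqP; rewrite eq_sym -subr_eq0 /= -linearB; apply/eqP/pi_B.
have -> : lmulh a f - lmulh a (vsval (cls f)) = lmulh a (f - vsval (cls f)).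
  by apply/lfunP => x; rewrite lmulhE !add_lfunE !opp_lfunE !lmulhE mulrBr.
exact/lmulh_B/pi_modB.
Qed.

Let tau_form_lin (theta : tau n Z) :
  linear ((fun g => (theta : 'Hom(subvs_of E, k^o)) (cls (infl g))) : mor W L -> k^o).
Proof. by move=> c f g; rewrite infl_lin cls_lin linearP. Qed.

Let tau_incl_fun (theta : tau n Z) : nu W := mk_nu (tau_form_lin theta).

Let tau_incl_lin : linear tau_incl_fun.
Proof.
move=> c f g; apply/nuappP => h; rewrite nuappDE nuappZE !mk_nuE.
by rewrite add_lfunE scale_lfunE.
Qed.

Let tau_incl_act theta a : tau_incl_fun (ract theta a) = ract (tau_incl_fun theta) a.
Proof.
apply/nuappP => g; rewrite [RHS]nuapp_act [LHS]mk_nuE [RHS]mk_nuE.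
rewrite [LHS]comp_lfunE; congr (fun_of_lfun _ _).
rewrite [LHS](@lactfE _ _ (Ext_regular n Z)) -[LHS]/(cls (lmulh a (vsval (cls (infl g))))).
rewrite (cls_act _ (inflZ g)); congr cls; apply/lfunP => x.
by rewrite lmulhE -[RHS]/((lmul a g \m fcover W) x) compmE lmulE -compmE.
Qed.

(* A form on Ext^n(Z, A) is read as a form on Hom(W, A), where W is the n-th syzygy of Z. *)
Definition tau_incl : mor (tau n Z) (nu W) := mk_mor tau_incl_lin tau_incl_act.

Let tau_inclE theta g :
  nuapp (tau_incl theta) g = (theta : 'Hom(subvs_of E, k^o)) (cls (infl g)).
Proof. by rewrite mk_morE [LHS]mk_nuE. Qed.

Lemma tau_incl_inj : inj tau_incl.
Proof.
move=> theta th0; apply/lfunP => x; rewrite zero_lfunE.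
have [g gE] := infl_surj (E_Z (subvsP x)).
have -> : x = cls (infl g) by apply/subvs_inj; rewrite -gE /= pi_id ?subvsP.
by have /nuappP/(_ g) := th0; rewrite tau_inclE nuapp0E.
Qed.

(** Ext^n(Z, A) is the cokernel of Hom(P_m, A) -> Hom(W, A); dualising makes [tau n Z] the kernel of
    [nu W -> nu (P m)], a description free of chosen representatives. *)
Lemma tau_incl_exact : exact tau_incl (nu_map inc).
Proof.
split=> [theta|phi phi0].
  apply/nuappP => h; rewrite nuapp0E nu_mapE tau_inclE.
  suff -> : cls (infl (h \m inc)) = 0 by rewrite linear0.
  by apply/subvs_inj; rewrite [LHS]pi_B //; apply/BP; exists h.
have sL : linear (fun g => cls (infl g)) by move=> c f g; rewrite infl_lin cls_lin.
have [g|theta thE] := @lfun_factor _ _ _ _ (lin_hom sL) (phi : 'Hom(hreg W, k^o)).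
  rewrite lin_homE => sg0.
  have /BP[h hE] : infl g \in B.
    have := pi_modB (inflZ g); have /(congr1 (@vsval _ _ _)) /= -> := sg0.
    by rewrite subr0.
  rewrite (infl_inj hE); have /nuappP/(_ h) := phi0.
  by rewrite nu_mapE nuapp0E.
exists theta; apply/nuappP => g; rewrite tau_inclE.
by have := thE g; rewrite lin_homE.
Qed.

Lemma ext_tau_zero : Ext_vanishes n Z L -> is_zero (tau n Z).
Proof.
move=> E0 theta; apply/lfunP => x; rewrite zero_lfunE.
suff -> : x = 0 by rewrite linear0.
by apply/subvs_inj/eqP; rewrite -memv0 -E0 subvsP.
Qed.
End TauKernel.

(** * Complexes of projectives and Ext duality *)

Section Complexes.
Variables (k : fieldType) (A : falgType k).
Implicit Types M N X Y Z P Q W K I S T U V : rmod A.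
Local Notation "'L'" := (regular A).

Lemma exact_surj_inj U V W I (f : mor U V) (d : mor V W) (q : mor V I) (a : mor I W) :
  surj q -> inj a -> d = a \m q ->
  (exact f d <-> exact f q) /\ (forall X (p : mor W X), exact d p <-> exact a p).
Proof.
move=> qs ai ->; split=> [|X p]; split=> -[e0 e1]; split=> [x|x].
- by apply: ai; rewrite -[a _]compmE.
- by move=> qx; apply: e1; rewrite compmE qx linear0.
- by rewrite compmE e0 linear0.
- by rewrite compmE => /ai; apply: e1.
- by have [y <-] := qs x; rewrite -[a _]compmE.
- by move=> /e1[y <-]; exists (q y); rewrite compmE.
- by rewrite compmE.
by move=> /e1[y <-]; have [z <-] := qs y; exists z; rewrite compmE.
Qed.

(** Maps out of [V] that kill [f] are the maps out of the image of [d], which is the kernel of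
    [p]. *)
Lemma E1_hom_exact U V W K (f : mor U V) (d : mor V W) (p : mor W K) Y :
  exact f d -> surj p -> exact d p -> lift_proj W ->
  E1 K Y <-> forall h : mor V Y, h \m f = 0 -> exists h', h = h' \m d.
Proof.
move=> fd ps dp Wp; have [I [q [a [qs ai dE]]]] := image_exists d.
have [fq ap] := exact_surj_inj f qs ai dE.
have sap : ses a p by split=> //; apply/ap.
rewrite (E1_proj _ sap Wp); split=> E h.
  move=> hf; have [h1 ->] := factor_coker qs (proj1 fq fd) hf.
  by have [h' ->] := E h1; exists h'; rewrite dE compmA.
have [|h'] := E (h \m q); first by rewrite -compmA (exact_comp0 (proj1 fq fd)) compm0.
by rewrite dE compmA => /(surj_cancel qs) hE; exists h'.
Qed.

Lemma E1_hom_coexact U V W K (f : mor U V) (d : mor V W) (i : mor K U) Y :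
  exact f d -> inj i -> exact i f -> ext_inj U ->
  E1 Y K <-> forall h : mor Y V, d \m h = 0 -> exists h', h = f \m h'.
Proof.
move=> fd ii exf Ui; have [I [q [a [qs ai fE]]]] := image_exists f.
have [iq ad] := exact_surj_inj i qs ai fE.
have siq : ses i q by split=> //; apply/iq.
rewrite (E1_inj _ siq Ui); split=> E h.
  move=> dh; have [h1 ->] := factor_ker ai (proj1 (ad _ d) fd) dh.
  by have [h' ->] := E h1; exists h'; rewrite fE compmA.
have [|h'] := E (a \m h); first by rewrite compmA (exact_comp0 (proj1 (ad _ d) fd)) comp0m.
by rewrite fE -compmA => /(inj_cancel ai) hE; exists h'.
Qed.

Lemma gen_exists M (x : M) : exists g : mor L M, forall a : A, g a = ract x a.
Proof.
have gL : linear (ract x : L -> M) by exact: ract_linearr.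
by exists (mk_mor gL (fun a b => ractM x a b)) => a; rewrite mk_morE.
Qed.

Lemma lift_proj_regular : lift_proj L.
Proof.
move=> M N g f gs; have [y gy] := gs (f (1 : A)); have [h hE] := gen_exists y.
by exists h; apply/morP => a; rewrite compmE hE morA gy -morA /= mul1r.
Qed.

Lemma exact_hom_regular U V W (f : mor U V) (d : mor V W) : d \m f = 0 ->
  (forall h : mor L V, d \m h = 0 -> exists h', h = f \m h') -> exact f d.
Proof.
move=> /morP df E; split=> [x|y dy]; first by have := df x; rewrite compmE mor0E.
have [g gE] := gen_exists y; have [|h hE] := E g.
  by apply/morP => a; rewrite compmE gE morA dy ract0l mor0E.
by exists (h (1 : A)); rewrite -compmE -hE gE ract1.
Qed.

(** By the pairing, linear forms on [M] give maps [M -> nu A], and linear forms separate points. *)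
Lemma nu_regular_cogenerator M (x : M) : (forall h : mor M (nu L), h x = 0) -> x = 0.
Proof.
move=> h0; apply/eqP/negP => /negP/lin_form_neq0[xi /eqP[]].
have pL : linear ((fun f => xi (f (1 : A))) : mor L M -> k^o).
  by move=> c u v; rewrite morDE morZE linearP.
have /nuappP/(_ (idm L)) := h0 (pairing (lin_hom pL)).
by rewrite pairingE lin_homE rk1E idmE ract1 nuapp0E.
Qed.

Lemma exact_hom_nu_regular U V W (f : mor U V) (d : mor V W) : d \m f = 0 ->
  (forall h : mor V (nu L), h \m f = 0 -> exists h', h = h' \m d) -> exact f d.
Proof.
move=> /morP df E; split=> [x|y dy]; first by have := df x; rewrite compmE mor0E.
have [Q [p [ps [ex0 ex1]]]] := coker_exists f; apply/ex1/nu_regular_cogenerator => h.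
have [|h' hE] := E (h \m p).
  by apply/morP => x; rewrite !compmE ex0 linear0 mor0E.
by rewrite -compmE hE compmE dy linear0.
Qed.

(* [up Z i d] and [down X j d] are the two halves, cut at the morphism d, of a complex *)
(* of projectives P_n -> ... -> P_0 with P_(i+1) -d-> P_i and n = i + j + 1: up says   *)
(* that the lower half is exact with cokernel Z, down that the upper half is exact     *)
(* after applying nu, with kernel X.                                                   *)
Fixpoint up Z i : forall U V, mor U V -> Prop :=
  match i with
  | 0 => fun U V d => lift_proj V /\ exists e : mor V Z, surj e /\ exact d e
  | i'.+1 => fun U V d => lift_proj V /\ exists W (e : mor V W), exact d e /\ up Z i' e
  end.

Fixpoint down X j : forall U V, mor U V -> Prop :=
  match j with
  | 0 => fun U V d => [/\ lift_proj U, lift_proj V &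
      exists i : mor X (nu U), inj i /\ exact i (nu_map d)]
  | j'.+1 => fun U V d => lift_proj V /\
      exists T (f : mor T U), exact (nu_map f) (nu_map d) /\ down X j' f
  end.

Lemma up_proj Z i U V (d : mor U V) : up Z i d -> lift_proj V.
Proof. by case: i => [|i] []. Qed.

Lemma down_proj X j U V (d : mor U V) : down X j d -> lift_proj U /\ lift_proj V.
Proof.
case: j => [[]//|j [Vp [T [f [_ ]]]]].
by case: j => [[]|j []].
Qed.

Lemma up_comp_surj Z i U U' V (d : mor U V) (p : mor U' U) :
  surj p -> up Z i d -> up Z i (d \m p).
Proof.
move=> ps; have dp W (e : mor V W) : exact d e -> exact (d \m p) e.
  move=> [e0 e1]; split=> [x|y /e1[x <-]]; first by rewrite compmE.
  by have [z <-] := ps x; exists z; rewrite compmE.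
case: i => [|i] [Vp].
  by move=> [e [es ex]]; split=> //; exists e; split=> //; apply: dp.
by move=> [W [e [ex ue]]]; split=> //; exists W, e; split=> //; apply: dp.
Qed.

Lemma up_coker Z i U V (d : mor U V) : up Z i d ->
  exists K (p : mor V K), [/\ surj p, exact d p & syz Z i K].
Proof.
elim: i U V d => [|i IH] U V d /=.
  by move=> [Vp [e [es ex]]]; exists Z, e.
move=> [Vp [W [e [de ue]]]]; have [K [p [ps ep sK]]] := IH _ _ _ ue.
have [I [q [a [qs ai eE]]]] := image_exists e.
have [dq ap] := exact_surj_inj d qs ai eE.
exists I, q; split=> //; first exact/dq.
exists K, W, a, p; split=> //; first exact: up_proj ue.
by split=> //; apply/ap.
Qed.

Lemma down_ker X j U V (d : mor U V) : down X j d ->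
  exists K (i : mor K (nu U)), [/\ inj i, exact i (nu_map d) & cosyz j X K].
Proof.
elim: j U V d => [|j IH] U V d /=.
  by move=> [_ _ [i [ii ex]]]; exists X, i.
move=> [Vp [T [f [fd df]]]]; have [K [i [ii fi cK]]] := IH _ _ _ df.
have [I [q [a [qs ai fE]]]] := image_exists (nu_map f).
have [iq ad] := exact_surj_inj i qs ai fE.
exists I, a; split=> //; first exact/ad.
have siq : ses i q by split=> //; apply/iq.
by apply: cosyzS cK _ siq; apply: nu_injective; have [] := down_proj df.
Qed.

(** Both sides are exactness at the middle term: the left one of Hom(-, Y) at [V], the right one of
    Hom(Y, nu -) at [nu V]. The pairing makes these two complexes dual. *)
Lemma ext_duality Z X i j U V W (f : mor U V) (d : mor V W) :
  up Z i d -> down X j f -> exact f d -> exact (nu_map f) (nu_map d) ->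
  forall Y, Ext_vanishes i.+1 Z Y <-> Ext_vanishes j.+1 Y X.
Proof.
move=> ud df fd nfd Y; have [Up Vp] := down_proj df; have Wp := up_proj ud.
have [K [p [ps dp sK]]] := up_coker ud; have [K' [a [ai fa cK]]] := down_ker df.
rewrite (ext_syz _ sK) (ext_cosyz _ cK).
rewrite (E1_hom_exact _ fd ps dp Wp) (E1_hom_coexact _ nfd ai fa (nu_injective Up)).
exact: hom_exact_duality (exact_comp0 fd).
Qed.

Definition spliced Z X i j := exists U V (d : mor U V), up Z i d /\ down X j d.

(** The cut moves one step towards [Z]. The exactness that is missing after [nu] is the duality
    tested at Y = A, since Hom(A, -) reflects exactness. *)
Lemma spliced_down Z X i j : spliced Z X i.+1 j -> Ext_vanishes i.+1 Z L ->
  spliced Z X i j.+1 /\ forall Y, Ext_vanishes i.+1 Z Y <-> Ext_vanishes j.+1 Y X.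
Proof.
move=> [U [V [f [[Vp [W [d [fd ud]]]] df]]]] Z0.
have [Up _] := down_proj df; have Wp := up_proj ud.
have nfd : exact (nu_map f) (nu_map d).
  apply: exact_hom_regular; first by rewrite -nu_comp (exact_comp0 fd) nu_zero.
  apply/(hom_exact_duality _ Up Vp Wp (exact_comp0 fd)).
  have [K [p [ps dp sK]]] := up_coker ud.
  by apply/(E1_hom_exact _ fd ps dp Wp)/(ext_syz _ sK).
split; last exact: (ext_duality ud df fd nfd).
by exists V, W, d; split=> //; split=> //; exists U, f.
Qed.

(** Here exactness is missing before [nu]. Faithfulness of [nu] gives a complex, and the duality
    tested at the cogenerator [nu A] gives exactness. *)
Lemma spliced_up Z X i j : spliced Z X i j.+1 -> Ext_vanishes j.+1 (nu L) X ->
  spliced Z X i.+1 j /\ forall Y, Ext_vanishes i.+1 Z Y <-> Ext_vanishes j.+1 Y X.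
Proof.
move=> [V [W [d [ud [Wp [U [f [nfd df]]]]]]]] X0.
have [Up Vp] := down_proj df.
have df0 : d \m f = 0 by apply: nu_faithful => //; rewrite nu_comp (exact_comp0 nfd).
have fd : exact f d.
  apply: exact_hom_nu_regular => //; apply/(hom_exact_duality _ Up Vp Wp df0).
  have [K [a [ai fa cK]]] := down_ker df.
  by apply/(E1_hom_coexact _ nfd ai fa (nu_injective Up))/(ext_cosyz _ cK).
split; last exact: (ext_duality ud df fd nfd).
by exists U, V, f; split=> //; split=> //; exists W, d.
Qed.

Lemma spliced_down_all Z X m : spliced Z X m 0 ->
  (forall i, (0 < i < m.+1)%N -> Ext_vanishes i Z L) ->
  forall j i, (i + j = m)%N -> spliced Z X i j.
Proof.
move=> s0 Z0; elim=> [|j IH] i ijm; first by rewrite addn0 in ijm; rewrite ijm.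
have ijm' : (i.+1 + j = m)%N by rewrite addSnnS.
have i0 : (0 < i.+1 < m.+1)%N by rewrite /= ltnS -ijm' leq_addr.
by have [] := spliced_down (IH _ ijm') (Z0 _ i0).
Qed.

Lemma spliced_up_all Z X m : spliced Z X 0 m ->
  (forall i, (0 < i < m.+1)%N -> Ext_vanishes i (nu L) X) ->
  forall i j, (i + j = m)%N -> spliced Z X i j.
Proof.
move=> s0 X0; elim=> [|i IH] j ijm; first by rewrite add0n in ijm; rewrite ijm.
have ijm' : (i + j.+1 = m)%N by rewrite -addSnnS.
have j0 : (0 < j.+1 < m.+1)%N by rewrite /= ltnS -ijm' leq_addl.
by have [] := spliced_up (IH _ ijm') (X0 _ j0).
Qed.

Lemma up_kcover Z i : up Z i (kcover (syzygy Z i)).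
Proof.
elim: i => [|i IH].
  have [ki cs ex] := ses_fcover Z; split; first exact: lift_proj_free.
  by exists (fcover Z).
have [ki cs ex] := ses_fcover (syzygy Z i.+1); have [ki' _ _] := ses_fcover (syzygy Z i).
split; first exact: lift_proj_free.
exists _, (kcover (syzygy Z i) \m fcover (syzygy Z i.+1)); split.
  by apply/(proj1 (exact_surj_inj _ cs ki' erefl)).
exact: up_comp_surj.
Qed.

Lemma tau_spliced m Z : gldim_le A m.+1 -> spliced Z (tau m.+1 Z) m 0.
Proof.
move=> gd; exists _, _, (kcover (syzygy Z m)); split; first exact: up_kcover.
split; [|exact: lift_proj_free|]; last first.
  by exists (tau_incl Z m); split; [apply: tau_incl_inj | apply: tau_incl_exact].
exact: (gldim_syz gd (syz_syzygy m.+1 Z)).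
Qed.

Lemma ext_to_tau m Z Y : gldim_le A m.+1 ->
  (forall i, (0 < i < m.+1)%N -> Ext_vanishes i Z L) ->
  (forall i, (0 < i < m.+1)%N -> Ext_vanishes i Z Y) ->
  forall i, (0 < i < m.+1)%N -> Ext_vanishes i Y (tau m.+1 Z).
Proof.
move=> gd ZL ZY [//|j] /= jm; rewrite ltnS in jm.
(* Degree [j.+1] is paired with degree [(m - j.+1).+1]: the two add up to n = [m.+1]. *)
have ijm : ((m - j.+1).+1 + j = m)%N by rewrite addSnnS subnK.
have i0 : (0 < (m - j.+1).+1 < m.+1)%N by rewrite /= ltnS ltn_subrL; case: (m) jm.
have [_ dual] := spliced_down (spliced_down_all (tau_spliced Z gd) ZL ijm) (ZL _ i0).
by apply/dual/ZY.
Qed.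

(** An injective coresolution of [X] by modules [nu P]; fullness of [nu] makes its differentials
    come from maps between the projectives. *)
Lemma down_exists X j : exists U V (d : mor U V), down X j d.
Proof.
elim: j => [|j [U [V [d dd]]]].
  have [P [Pp [a ai]]] := embed_nu X; have [Q [q [qs aq]]] := coker_exists a.
  have [P' [Pp' [b bi]]] := embed_nu Q; have [d dE] := nu_full (b \m q) Pp'.
  exists P, P', d; split=> //; exists a; split=> //.
  by apply/(proj1 (exact_surj_inj a qs bi (esym dE))).
have [Q [q [qs aq]]] := coker_exists (nu_map d).
have [P' [Pp' [b bi]]] := embed_nu Q; have [e eE] := nu_full (b \m q) Pp'.
exists V, P', e; split=> //; exists U, d; split=> //.
by apply/(proj1 (exact_surj_inj _ qs bi (esym eE))).
Qed.

(** A retraction up to a map through a projective passes to syzygies. The error there has the form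
    [t \m a], so after [nu] it vanishes on the kernel of [nu_map a]. *)
Lemma ses_compare I V K I' V' K' (a : mor I V) (p : mor V K) (a' : mor I' V') (p' : mor V' K')
    (u : mor K K') (v : mor K' K) Q (al : mor K Q) (be : mor Q K) :
  ses a p -> lift_proj V -> ses a' p' -> lift_proj V' -> lift_proj Q ->
  v \m u = idm K + be \m al ->
  exists (uI : mor I I') (vI : mor I' I) (uV : mor V V') (vV : mor V' V) (t : mor V I),
    [/\ a' \m uI = uV \m a, a \m vI = vV \m a' & vI \m uI = idm I + t \m a].
Proof.
move=> [ai ps ap] Vp [ai' ps' ap'] Vp' Qp vu.
have [uV uVE] := Vp _ _ p' (u \m p) ps'; have [vV vVE] := Vp' _ _ p (v \m p') ps.
have [b bE] := Qp _ _ p be ps.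
have [|uI uIE] := @factor_ker _ _ _ _ _ _ _ _ (uV \m a) ai' ap'.
  by rewrite compmA -uVE -compmA (exact_comp0 ap) compm0.
have [|vI vIE] := @factor_ker _ _ _ _ _ _ _ _ (vV \m a') ai ap.
  by rewrite compmA -vVE -compmA (exact_comp0 ap') compm0.
have [|t tE] := @factor_ker _ _ _ _ _ _ _ _ (vV \m uV - idm V - b \m al \m p) ai ap.
  rewrite !compmBr compm1 !compmA -vVE -(compmA v) -uVE compmA vu -bE.
  by rewrite compmDl comp1m [p + _]addrC addrK subrr.
exists uI, vI, uV, vV, t; split=> //; apply: (inj_cancel ai).
rewrite compmA -vIE -compmA -uIE compmA compmDr compm1 compmA -tE !compmBl comp1m.
rewrite -(compmA (b \m al)) (exact_comp0 ap) compm0 subr0.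
by rewrite addrC subrK.
Qed.

Lemma syz_compare Z j K K' : syz Z j K -> syz Z j K' ->
  exists (u : mor K K') (v : mor K' K) Q (al : mor K Q) (be : mor Q K),
    lift_proj Q /\ v \m u = idm K + be \m al.
Proof.
elim: j K K' => [|j IH] K K' /=.
  move=> -> ->; exists (idm Z), (idm Z), L, 0, 0; rewrite comp1m comp0m addr0.
  by split=> //; exact: lift_proj_regular.
move=> [K1 [P1 [i1 [p1 [s1 P1p ses1]]]]] [K2 [P2 [i2 [p2 [s2 P2p ses2]]]]].
have [u [v [Q [al [be [Qp vu]]]]]] := IH _ _ s1 s2.
have [uI [vI [_ [_ [t [_ _ vuI]]]]]] := ses_compare ses1 P1p ses2 P2p Qp vu.
by exists uI, vI, P1, i1, t.
Qed.

Lemma ext_from_tau m X : gldim_le A m.+1 ->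
  (forall i, (0 < i < m.+1)%N -> Ext_vanishes i (nu L) X) ->
  exists Z,
    (forall Y, (forall i, (0 < i < m.+1)%N -> Ext_vanishes i Y X) ->
       forall i, (0 < i < m.+1)%N -> Ext_vanishes i Z Y) /\
    exists U (x1 : mor X (tau m.+1 Z)) (y1 : mor (tau m.+1 Z) X)
      (x2 : mor X (nu U)) (y2 : mor (nu U) X),
      lift_proj U /\ idm X = y1 \m x1 + y2 \m x2.
Proof.
move=> gd X0; have [U0 [V0 [d0 dd0]]] := down_exists X m.
have [Z [e [es de]]] := coker_exists d0; exists Z.
have s0 : spliced Z X 0 m.
  exists U0, V0, d0; split=> //; split; first by have [] := down_proj dd0.
  by exists e.
split=> [Y YX [//|i] /= im|].
  rewrite ltnS in im; have ijm : (i + (m - i.+1).+1 = m)%N by rewrite addnS -addSn subnKC.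
  have j0 : (0 < (m - i.+1).+1 < m.+1)%N by rewrite /= ltnS ltn_subrL; case: (m) im.
  have [_ dual] := spliced_up (spliced_up_all s0 X0 ijm) (X0 _ j0).
  by apply/dual/YX.
have [U [V [d [ud [Up Vp [io [ioi iod]]]]]]] := spliced_up_all s0 X0 (addn0 m).
have [K [p [ps dp sK]]] := up_coker ud.
have [I [q [a [qs ai dE]]]] := image_exists d.
have [_ ap] := exact_surj_inj (0 : mor U U) qs ai dE.
have sap : ses a p by split=> //; apply/ap.
(* [I] is an n-th syzygy of [Z], hence projective, so [q] splits. Accordingly [X], the kernel of
   [nu_map d], splits into the kernel [X'] of [nu_map a] and a summand of [nu U]. *)
have Ip : lift_proj I.
  by apply: (@gldim_syz _ _ m.+1 Z) => //; exists K, V, a, p.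
have [s qsE] := split_epi_proj Ip qs.
have [X' [b [bi ba]]] := ker_exists (nu_map a).
pose T0 := tau_incl Z m; have Ti := @tau_incl_inj _ _ Z m; have Tk := @tau_incl_exact _ _ Z m.
(* Comparing [a] with the corresponding inclusion in the free resolution makes [X'] a direct summand
   of [tau m.+1 Z]. *)
have [u [v [Q [al [be [Qp vu]]]]]] := syz_compare sK (syz_syzygy m Z).
have [uI [vI [uV [vV [t [uE vE vuE]]]]]] :=
  ses_compare sap Vp (ses_fcover _) (@lift_proj_free _ _ _) Qp vu.
have [|g gE] := @factor_ker _ _ _ _ _ _ _ _ (nu_map uI \m b) Ti Tk.
  by rewrite compmA -nu_comp uE nu_comp -compmA (exact_comp0 ba) compm0.
have [|g' g'E] := @factor_ker _ _ _ _ _ _ _ _ (nu_map vI \m T0) bi ba.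
  by rewrite compmA -nu_comp vE nu_comp -compmA (exact_comp0 Tk) compm0.
have g'g : g' \m g = idm X'.
  apply: (inj_cancel bi); rewrite compmA -g'E -compmA -gE compmA -nu_comp vuE compm1.
  rewrite nu_add nu_id nu_comp compmDl comp1m -compmA (exact_comp0 ba).
  by rewrite compm0 addr0.
have [|x xE] := @factor_ker _ _ _ _ _ _ _ _ (nu_map q \m io) bi ba.
  by rewrite compmA -nu_comp -dE (exact_comp0 iod).
have [|y yE] := @factor_ker _ _ _ _ _ _ _ _ (nu_map s \m b) ioi iod.
  rewrite compmA -nu_comp dE -compmA qsE compm1; exact: exact_comp0.
have [|z zE] := @factor_ker _ _ _ _ _ _ _ _ (nu_map (idm U - s \m q)) ioi iod.
  by rewrite -nu_comp dE compmBr compm1 compmA -(compmA a) qsE compm1 subrr nu_zero.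
exists U, (g \m x), (y \m g'), io, z; split=> //.
apply: (inj_cancel ioi).
rewrite compm1 -(compmA y) (compmA g') g'g comp1m compmDr !compmA -yE -zE.
rewrite -(compmA _ b) -xE nu_sub nu_id compmBl comp1m nu_comp compmA.
by rewrite addrC subrK.
Qed.

End Complexes.

(** * Functoriality of the translate *)

Section TauFunctor.
Variables (k : fieldType) (A : falgType k).
Implicit Types M N X Y Z P Q W K I S T U V : rmod A.
Local Notation "'L'" := (regular A).

(** A relation, since the lift [g] of [f] is unique only up to maps into the syzygy of [K'].
    Linearity reduces the ambiguity to the lifts of zero. *)
Definition omega_rel K K' (f : mor K K') (f' : mor (syzygy K 1) (syzygy K' 1)) : Prop :=
  exists g, fcover K' \m g = f \m fcover K /\ g \m kcover K = kcover K' \m f'.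

Fixpoint syzygy_rel Z Z' (f : mor Z Z') i : mor (syzygy Z i) (syzygy Z' i) -> Prop :=
  match i with
  | 0 => fun f' => f' = f
  | i'.+1 => fun f' => exists fi, syzygy_rel f fi /\ omega_rel fi f'
  end.

Lemma omega_rel_lin K K' c (f1 f2 : mor K K') f1' f2' :
  omega_rel f1 f1' -> omega_rel f2 f2' -> omega_rel (c *: f1 + f2) (c *: f1' + f2').
Proof.
move=> [g1 [pg1 gk1]] [g2 [pg2 gk2]]; exists (c *: g1 + g2).
by rewrite !compmDr !compmDl !compmZl !compmZr pg1 pg2 gk1 gk2.
Qed.

Lemma omega_rel_comp K K' K'' (f : mor K K') (h : mor K' K'') f' h' :
  omega_rel f f' -> omega_rel h h' -> omega_rel (h \m f) (h' \m f').
Proof.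
move=> [g1 [pg1 gk1]] [g2 [pg2 gk2]]; exists (g2 \m g1).
split; first by rewrite compmA pg2 -compmA pg1 compmA.
by rewrite -compmA gk1 compmA gk2 -compmA.
Qed.

Lemma omega_rel_id K : omega_rel (idm K) (idm (syzygy K 1)).
Proof. by exists (idm _); rewrite !compm1 !comp1m. Qed.

Lemma omega_rel_total K K' (f : mor K K') : exists f', omega_rel f f'.
Proof.
have [ki cs ex] := ses_fcover K; have [ki' cs' ex'] := ses_fcover K'.
have [g gE] := @lift_proj_free _ _ _ _ _ (fcover K') (f \m fcover K) cs'.
have [|f' f'E] := @factor_ker _ _ _ _ _ _ _ _ (g \m kcover K) ki' ex'.
  by rewrite compmA -gE -compmA (exact_comp0 ex) compm0.
by exists f', g.
Qed.

Lemma omega_rel_descends K K' (g : mor (free_mod A (\dim {:K})) (free_mod A (\dim {:K'}))) f' :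
  g \m kcover K = kcover K' \m f' -> exists f, omega_rel f f'.
Proof.
have [ki cs ex] := ses_fcover K; have [ki' cs' ex'] := ses_fcover K'.
move=> gk; have [|f fE] := @factor_coker _ _ _ _ _ _ _ _ (fcover K' \m g) cs ex.
  by rewrite -compmA gk compmA (exact_comp0 ex') comp0m.
by exists f, g.
Qed.

(** The cover of [K'] is free, so Ext^1(K, A) = 0 extends [kcover K' \m f'] over the free cover of
    [K]. *)
Lemma omega_rel_full K K' f' : E1 K L -> exists f : mor K K', omega_rel f f'.
Proof.
move=> /(E1_regular (@lift_proj_free _ _ (\dim {:K'}))) E.
have [g gE] := E _ _ _ _ (ses_fcover K) (kcover K' \m f').
exact: omega_rel_descends (esym gE).
Qed.

(** Lifting [be] to the cover of [K'] gives a lift of [be \m al] that is zero on the syzygy of [K];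
    any other lift differs from it by a map into the syzygy of [K']. *)
Lemma omega_rel_proj K K' Q (al : mor K Q) (be : mor Q K') f' :
  lift_proj Q -> omega_rel (be \m al) f' -> exists s, f' = s \m kcover K.
Proof.
have [ki cs ex] := ses_fcover K; have [ki' cs' ex'] := ses_fcover K'.
move=> Qp [g [pg gk]]; have [b bE] := Qp _ _ (fcover K') be cs'.
have [|s sE] := @factor_ker _ _ _ _ _ _ _ _ (g - b \m al \m fcover K) ki' ex'.
  by rewrite compmBr pg !compmA -bE subrr.
exists s; apply: (inj_cancel ki'); rewrite -gk compmA -sE compmBl -!compmA.
by rewrite (exact_comp0 ex) !compm0 subr0.
Qed.

Section SyzygyRel.
Variables Z Z' : rmod A.

Lemma syzygy_rel_lin c i (f1 f2 : mor Z Z') (f1' f2' : mor (syzygy Z i) (syzygy Z' i)) :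
  syzygy_rel f1 f1' -> syzygy_rel f2 f2' -> syzygy_rel (c *: f1 + f2) (c *: f1' + f2').
Proof.
elim: i f1' f2' => [|i IH] f1' f2' /=; first by move=> -> ->.
move=> [g1 [sg1 og1]] [g2 [sg2 og2]]; exists (c *: g1 + g2).
by split; [apply: IH | apply: omega_rel_lin].
Qed.

Lemma syzygy_rel_total i (f : mor Z Z') :
  exists f' : mor (syzygy Z i) (syzygy Z' i), syzygy_rel f f'.
Proof.
elim: i => [|i [fi sfi]]; first by exists f.
by have [f' of'] := omega_rel_total fi; exists f', fi.
Qed.

Lemma syzygy_rel_full i (f' : mor (syzygy Z i) (syzygy Z' i)) :
  (forall j, (0 < j <= i)%N -> Ext_vanishes j Z L) -> exists f : mor Z Z', syzygy_rel f f'.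
Proof.
elim: i f' => [|i IH] f' ext0; first by exists f'.
have [|fi ofi] := omega_rel_full f'; first by apply/ext_vanishesP/ext0; rewrite /= ltnSn.
have [j /andP[j0 ji]|f sf] := IH fi; first by apply: ext0; rewrite j0 ltnW.
by exists f, fi.
Qed.

Lemma syzygy_rel_zero i (f' : mor (syzygy Z i.+1) (syzygy Z' i.+1)) :
  syzygy_rel 0 f' -> exists s, f' = s \m kcover (syzygy Z i).
Proof.
elim: i f' => [|i IH] f' [fi [sfi ofi]].
  apply: (@omega_rel_proj _ _ L 0 0); first exact: lift_proj_regular.
  by rewrite comp0m -sfi.
have [s sE] := IH _ sfi; rewrite sE in ofi.
exact: (omega_rel_proj (@lift_proj_free _ _ _) ofi).
Qed.
End SyzygyRel.

Lemma syzygy_rel_comp Z Z' Z'' i (f : mor Z Z') (g : mor Z' Z'')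
    (f' : mor (syzygy Z i) (syzygy Z' i)) (g' : mor (syzygy Z' i) (syzygy Z'' i)) :
  syzygy_rel f f' -> syzygy_rel g g' -> syzygy_rel (g \m f) (g' \m f').
Proof.
elim: i f' g' => [|i IH] f' g' /=; first by move=> -> ->.
move=> [f1 [sf1 of1]] [g1 [sg1 og1]]; exists (g1 \m f1).
by split; [apply: IH | apply: omega_rel_comp].
Qed.

Lemma syzygy_rel_id Z i : syzygy_rel (idm Z) (idm (syzygy Z i)).
Proof.
elim: i => [//|i IH]; exists (idm _); split=> //; exact: omega_rel_id.
Qed.

(* The graph of f |-> tau f, defined up to the choice of a lift of f to the m.+1-st *)
(* syzygies.                                                                        *)
Definition tau_rel m Z Z' (f : mor Z Z') (g : mor (tau m.+1 Z) (tau m.+1 Z')) : Prop :=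
  exists f' : mor (syzygy Z m.+1) (syzygy Z' m.+1),
    syzygy_rel f f' /\ tau_incl Z' m \m g = nu_map f' \m tau_incl Z m.

Section TauRel.
Variable m : nat.

Lemma nu_scale X Y c (f : mor X Y) : nu_map (c *: f) = c *: nu_map f.
Proof.
apply/morP => phi; apply/nuappP => h.
by rewrite morZE nuappZE !nu_mapE compmZr linearZ.
Qed.

Lemma tau_rel_lin Z Z' c (f1 f2 : mor Z Z') (g1 g2 : mor (tau m.+1 Z) (tau m.+1 Z')) :
  tau_rel f1 g1 -> tau_rel f2 g2 -> tau_rel (c *: f1 + f2) (c *: g1 + g2).
Proof.
move=> [f1' [s1 t1]] [f2' [s2 t2]]; exists (c *: f1' + f2').
split; first exact: syzygy_rel_lin.
by rewrite compmDr compmZr t1 t2 nu_add nu_scale compmDl compmZl.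
Qed.

Lemma tau_rel_comp Z Z' Z'' (f : mor Z Z') (h : mor Z' Z'')
    (f' : mor (tau m.+1 Z) (tau m.+1 Z')) (h' : mor (tau m.+1 Z') (tau m.+1 Z'')) :
  tau_rel f f' -> tau_rel h h' -> tau_rel (h \m f) (h' \m f').
Proof.
move=> [u [su tu]] [v [sv tv]]; exists (v \m u).
split; first exact: syzygy_rel_comp.
by rewrite nu_comp compmA tv -compmA tu compmA.
Qed.

Lemma tau_rel_id Z : tau_rel (idm Z) (idm (tau m.+1 Z)).
Proof.
exists (idm _); split; first exact: syzygy_rel_id.
by rewrite nu_id comp1m compm1.
Qed.

(** This makes [tau_rel] single-valued: a lift of 0 factors through [kcover (syzygy Z m)], and [nu]
    of that map has [tau m.+1 Z] as its kernel. *)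
Lemma tau_rel_zero Z Z' (g : mor (tau m.+1 Z) (tau m.+1 Z')) :
  tau_rel (0 : mor Z Z') g -> g = 0.
Proof.
move=> [f' [sf tf]]; have [s sE] := syzygy_rel_zero sf.
apply: (inj_cancel (@tau_incl_inj _ _ Z' m)).
by rewrite tf compm0 sE nu_comp -compmA (exact_comp0 (@tau_incl_exact _ _ Z m)) compm0.
Qed.

Lemma tau_rel_add Z Z' (f1 f2 : mor Z Z') (g1 g2 : mor (tau m.+1 Z) (tau m.+1 Z')) :
  tau_rel f1 g1 -> tau_rel f2 g2 -> tau_rel (f1 + f2) (g1 + g2).
Proof. by move=> t1 t2; have := tau_rel_lin 1 t1 t2; rewrite !scale1r. Qed.

Lemma tau_rel_fun Z Z' (f : mor Z Z') (g1 g2 : mor (tau m.+1 Z) (tau m.+1 Z')) :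
  tau_rel f g1 -> tau_rel f g2 -> g1 = g2.
Proof.
move=> t1 t2; have := tau_rel_lin (-1) t2 t1; rewrite !scaleN1r addNr.
by move/tau_rel_zero/eqP; rewrite addrC subr_eq0 => /eqP.
Qed.

Lemma tau_rel_total Z Z' (f : mor Z Z') : exists g : mor (tau m.+1 Z) _, tau_rel f g.
Proof.
have [f' sf] := syzygy_rel_total m.+1 f; have [fm [sfm [g [pg gk]]]] := sf.
have ex := @tau_incl_exact _ _ Z m; have ex' := @tau_incl_exact _ _ Z' m.
have [|h hE] := @factor_ker _ _ _ _ _ _ _ _ (nu_map f' \m tau_incl Z m)
  (@tau_incl_inj _ _ Z' m) ex'.
  by rewrite compmA -nu_comp -gk nu_comp -compmA (exact_comp0 ex) compm0.
by exists h, f'.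
Qed.

Hypothesis gd : gldim_le A m.+1.

Lemma syzygy_top_proj Z : lift_proj (syzygy Z m.+1).
Proof. exact: gldim_syz gd (syz_syzygy m.+1 Z). Qed.

(** Injectivity extends [g] to the top two [nu]-terms, and full faithfulness of [nu] on projectives
    turns the extension into a commutative square, hence into a map of m-th syzygies. Only the
    descent from there to [Z] uses the vanishing of Ext. *)
Lemma tau_rel_full Z Z' (g : mor (tau m.+1 Z) (tau m.+1 Z')) :
  (forall i, (0 < i < m.+1)%N -> Ext_vanishes i Z L) -> exists f : mor Z Z', tau_rel f g.
Proof.
move=> ext0; have Fp := @lift_proj_free _ A (\dim {:syzygy Z' m}).
have ex := @tau_incl_exact _ _ Z m; have ex' := @tau_incl_exact _ _ Z' m.
have [Phi PhiE] := nu_injective (@syzygy_top_proj Z') (tau_incl Z' m \m g)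
  (@tau_incl_inj _ _ Z m).
have [f' f'E] := nu_full Phi (@syzygy_top_proj Z'); rewrite f'E in PhiE.
have [I [q [a [qs ai kE]]]] := image_exists (nu_map (kcover (syzygy Z m))).
have [exq _] := exact_surj_inj (tau_incl Z m) qs ai kE.
have [|h hE] := @factor_coker _ _ _ _ _ _ _ _
    (nu_map (kcover (syzygy Z' m)) \m nu_map f') qs (proj1 exq ex).
  by rewrite -compmA -PhiE compmA (exact_comp0 ex') comp0m.
have [Psi PsiE] := nu_injective Fp h ai.
have [d dE] := nu_full Psi Fp.
have [|fm ofm] := @omega_rel_descends _ _ d f'.
  apply/eqP; rewrite -subr_eq0; apply/eqP/(nu_faithful Fp).
  by rewrite nu_sub !nu_comp kE compmA -dE -PsiE -hE subrr.
have [f sf] := syzygy_rel_full fm ext0.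
by exists f, f'; split=> //; exists fm.
Qed.

Lemma tau_projective P : lift_proj P -> is_zero (tau m.+1 P).
Proof. by move=> Pp; apply/ext_tau_zero/ext_projective. Qed.

(** Composed with [tau_incl], [g] is [nu] of some [d : A -> syzygy Z m.+1]. Since [nu] of [kcover]
    kills [tau], faithfulness gives [kcover _ \m d = 0], and [kcover] is injective. *)
Lemma hom_injective_tau Z (g : mor (nu L) (tau m.+1 Z)) : g = 0.
Proof.
apply: (inj_cancel (@tau_incl_inj _ _ Z m)); rewrite compm0.
have [d dE] := nu_full (tau_incl Z m \m g) (@syzygy_top_proj Z).
have ex := @tau_incl_exact _ _ Z m; have [ki _ _] := ses_fcover (syzygy Z m).
rewrite dE; suff -> : d = 0 by rewrite nu_zero.
apply: (inj_cancel ki); rewrite compm0; apply: (nu_faithful (@lift_proj_free _ _ _)).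
by rewrite nu_comp -dE compmA (exact_comp0 ex) comp0m.
Qed.
End TauRel.
End TauFunctor.

(** * Additive closures *)

Section AddClosure.
Variables (k : fieldType) (A : falgType k).
Implicit Types M N X Y Z P Q W K I S T U V : rmod A.
Implicit Types C : subcat A.
Local Notation "'L'" := (regular A).

(* X lies in add C if and only if its identity is a finite sum of morphisms that factor *)
(* through objects of C, see [addP].                                                    *)
Inductive through C X Y : mor X Y -> Prop :=
  | through0 : through C 0
  | throughS Z (p : mor Z Y) (q : mor X Z) f : C Z -> through C f -> through C (p \m q + f).

Lemma through1 C X Y Z (p : mor Z Y) (q : mor X Z) : C Z -> through C (p \m q).
Proof. by move=> CZ; rewrite -[_ \m _]addr0; apply: throughS => //; apply: through0. Qed.

Lemma through_obj C X : C X -> through C (idm X).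
Proof. by move=> CX; rewrite -(compm1 (idm X)); apply: through1. Qed.

Lemma throughD C X Y (f g : mor X Y) : through C f -> through C g -> through C (f + g).
Proof.
move=> Cf Cg; elim: Cf => [|Z p q f1 CZ _ IH]; first by rewrite add0r.
by rewrite -addrA; apply: throughS.
Qed.

Lemma through_sum C X Y (J : Type) (r : seq J) (F : J -> mor X Y) :
  (forall j, through C (F j)) -> through C (\sum_(j <- r) F j).
Proof.
move=> CF; elim: r => [|j r IH]; first by rewrite big_nil; apply: through0.
by rewrite big_cons; apply: throughD.
Qed.

Lemma through_compl C X Y Z (h : mor Y Z) (f : mor X Y) : through C f -> through C (h \m f).
Proof.
elim=> [|V p q f1 CV _ IH]; first by rewrite compm0; apply: through0.
by rewrite compmDr compmA; apply: throughS.
Qed.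

Lemma through_compr C X Y Z (f : mor Y Z) (h : mor X Y) : through C f -> through C (f \m h).
Proof.
elim=> [|V p q f1 CV _ IH]; first by rewrite comp0m; apply: through0.
by rewrite compmDl -compmA; apply: throughS.
Qed.

Lemma through_sub C C' X Y (f : mor X Y) :
  (forall Z, C Z -> through C' (idm Z)) -> through C f -> through C' f.
Proof.
move=> CC'; elim=> [|V p q f1 CV _ IH]; first exact: through0.
by apply: throughD => //; rewrite -(compm1 p); apply/through_compr/through_compl/CC'.
Qed.

Lemma through_zero C X Y (f : mor X Y) : (forall Z, C Z -> forall p : mor Z Y, p = 0) ->
  through C f -> f = 0.
Proof. by move=> C0; elim=> [//|V p q f1 CV _ ->]; rewrite (C0 _ CV p) comp0m addr0. Qed.

Lemma lift_proj_through C X : (forall Z, C Z -> lift_proj Z) -> through C (idm X) -> lift_proj X.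
Proof.
move=> Cp; suff lift Y (f : mor X Y) : through C f -> forall M N (g : mor M N) (h : mor Y N),
    surj g -> exists l, h \m f = g \m l.
  by move=> /lift lX M N g h gs; have := lX _ _ g h gs; rewrite compm1.
elim=> [|V p q f1 CV _ IH] M N g h gs; first by exists 0; rewrite !compm0.
have [l1 hl1] := IH _ _ g h gs; have [l0 hl0] := Cp _ CV _ _ g (h \m p) gs.
by exists (l0 \m q + l1); rewrite !compmDr !compmA hl0 hl1.
Qed.

Lemma bigsum_through C m (F : 'I_m -> rmod A) :
  (forall i, C (F i)) -> through C (idm (\big[@dsum _ _/zero_mod A]_(i < m) F i)).
Proof.
elim: m F => [|m IH] F CF.
  rewrite big_ord0; have -> : idm (zero_mod A) = 0; last exact: through0.
  by apply/is_zero_idm => x; apply/rowP => -[].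
rewrite big_ord_recl dsum_idm; apply: throughS => //.
rewrite -(compm1 (dinr _ _)); apply/through_compr/through_compl/IH => i; exact: CF.
Qed.

Lemma bigsum_retract m (F : 'I_m -> rmod A) i :
  exists (a : mor (F i) (\big[@dsum _ _/zero_mod A]_(i < m) F i)) b, b \m a = idm (F i).
Proof.
elim: m F i => [|m IH] F i; first by case: i.
rewrite big_ord_recl; case: (unliftP ord0 i) => [j|] ->.
  have [a [b ba]] := IH (fun j => F (lift ord0 j)) j.
  exists (dinr _ _ \m a), (b \m dsnd _ _).
  by rewrite compmA -(compmA b) dsnd_inr compm1.
by exists (dinl _ _), (dfst _ _); rewrite dfst_inl.
Qed.

Lemma through_bigsum C X Y (f : mor X Y) : through C f ->
  exists m (F : 'I_m -> rmod A), (forall i, C (F i)) /\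
    exists (u : mor X (\big[@dsum _ _/zero_mod A]_(i < m) F i)) v, f = v \m u.
Proof.
elim=> [|Z p q f1 CZ _ [m [F [CF [u [v ->]]]]]].
  by exists 0%N, (fun _ => L); split=> [[]//|]; exists 0, 0; rewrite comp0m.
exists m.+1, (fun i => oapp F Z (unlift ord0 i)); split=> [i|].
  by case: (unlift ord0 i) => [j|] /=.
rewrite big_ord_recl unlift_none /=.
rewrite (eq_bigr F) => [|i _]; last by rewrite liftK.
exists (dpair q u), (p \m dfst _ _ + v \m dsnd _ _).
by apply/morP => x; rewrite !(morDE, compmE) dfstE dsndE dpairE.
Qed.

Lemma addP C X : Defs.add C X <-> through C (idm X).
Proof.
split=> [[m [F [CF /summandP[i [p <-]]]]]|/through_bigsum[m [F [CF [u [v vu]]]]]].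
  by rewrite -(compm1 p); apply/through_compr/through_compl/bigsum_through.
by exists m, F; split=> //; apply/summandP; exists u, v.
Qed.
End AddClosure.

(** * Cluster tilting and completeness *)

Section LinearRelation.
Variables (k : fieldType) (V W : vectType k) (R : V -> W -> Prop).
Hypothesis R_lin : forall c v v' w w', R v w -> R v' w' -> R (c *: v + v') (c *: w + w').
Hypothesis R_tot : forall v, exists w, R v w.
Hypothesis R_fun : forall w, R 0 w -> w = 0.
Hypothesis R_full : forall w, exists v, R v w.

(** [R] is the graph of a linear map [r], which is onto by [R_full]; the rest is rank-nullity. *)
Lemma lin_rel_dim : (\dim {:W} <= \dim {:V})%N /\
  ((\dim {:V} <= \dim {:W})%N -> forall v, R v 0 -> v = 0).
Proof.
have R0 : R 0 0.
  by have [w Rw] := R_tot 0; have := R_lin (-1) Rw Rw; rewrite !scaleN1r !addNr.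
pose b := vbasis {:V}.
have [w wE] := fin_all_exists (fun i : 'I_(\dim {:V}) => R_tot b`_i).
have rL : linear (fun v => \sum_(i < \dim {:V}) coord b i v *: w i).
  move=> c u v; rewrite scaler_sumr -big_split; apply: eq_bigr => i _.
  by rewrite linearP scalerDl scalerA.
pose r := lin_hom rL.
have Rr v : R v (r v).
  rewrite lin_homE {1}(coord_vbasis (memvf v)).
  by elim/big_rec2: _ => [//|i v' w' _ Rvw]; apply: R_lin.
have RrE v u : R v u -> u = r v.
  move=> Rvu; have := R_lin (-1) (Rr v) Rvu; rewrite scaleN1r addNr => /R_fun/eqP.
  by rewrite scaleN1r addrC subr_eq0 => /eqP.
have rs : limg r = fullv.
  apply/vspaceP => u; rewrite memvf; have [v /RrE ->] := R_full u.
  by rewrite memv_img ?memvf.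
have := limg_ker_dim r fullv; rewrite rs capfv => dE.
split=> [|VW v /RrE rv]; first by rewrite -dE leq_addl.
have : (\dim (lker r) == 0)%N by rewrite -leqn0 -(leq_add2r (\dim {:W})) dE.
rewrite dimv_eq0 => /eqP r0; apply/eqP.
by rewrite -memv0 -r0 memv_ker -rv.
Qed.
End LinearRelation.

Lemma nat_seq_nondecreasing_step (d : nat -> nat) : exists j, (d j <= d j.+1)%N.
Proof.
suff: forall N j, (d j <= N)%N -> exists j, (d j <= d j.+1)%N by move=> H; exact: H (leqnn (d 0)).
elim=> [|N IH] j dN; first by exists j; move: dN; rewrite leqn0 => /eqP ->.
have [dj|/leq_trans/(_ dN) dj] := leqP (d j) (d j.+1); first by exists j.
exact: IH dj.
Qed.

Section Completeness.
Variables (k : fieldType) (A : falgType k).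
Implicit Types M N X Y Z P Q W K I S T U V : rmod A.
Implicit Types C : subcat A.
Local Notation "'L'" := (regular A).
Local Notation "'DL'" := (dualreg A).

Lemma is_zero_hom X : (forall f : mor L X, f = 0) -> is_zero X.
Proof.
by move=> f0 x; have [g gE] := gen_exists x; rewrite -[x]ract1 -gE (f0 g) mor0E.
Qed.

Lemma ext_inj_dualreg : ext_inj DL.
Proof.
have /isoP[f [g [fg gf]]] := iso_dualreg A.
exact: ext_inj_retract gf (nu_injective (@lift_proj_regular _ A)).
Qed.

Lemma through_projective P : lift_proj P -> through (fun Z => Z = L) (idm P).
Proof.
move=> /dual_basis[r [p [g pg]]].
have -> : idm P = \sum_i rk1 (p i) (idm L) \m g i.
  apply/morP => x; rewrite idmE mor_sumE {1}(pg x); apply: eq_bigr => i _.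
  by rewrite compmE rk1E idmE.
by apply: through_sum => i; apply: through1.
Qed.

Lemma through_nu_projective P : lift_proj P -> through (fun Z => Z = DL) (idm (nu P)).
Proof.
move=> /through_projective; suff nuF X Y (f : mor X Y) :
    through (fun Z => Z = L) f -> through (fun Z => Z = DL) (nu_map f).
  by move/nuF; rewrite nu_id.
have /isoP[u [v [uv vu]]] := iso_dualreg A.
elim=> [|Z p q f1 ZL _ IH]; first by rewrite nu_zero; apply: through0.
subst Z.
rewrite nu_add nu_comp -[nu_map p]compm1 -uv compmA -compmA.
by apply: throughS.
Qed.

Lemma add1_projective X : add1 L X <-> lift_proj X.
Proof.
rewrite /add1 addP; split=> [|/through_projective //].
by apply: lift_proj_through => Z ->; apply: lift_proj_regular.
Qed.

Lemma cluster_tilting_ext n (S S' C C' : subcat A) :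
  subcat_eq S S' -> subcat_eq C C' -> cluster_tilting n S C -> cluster_tilting n S' C'.
Proof.
move=> SS CC [ff l r]; split.
- move=> X /SS/ff[[C0 [f [CC0 fh fE]]] [C1 [g [CC1 gh gE]]]]; split.
    exists C0, f; split=> //; first exact/CC.
    by move=> D h /CC; apply: fE.
  exists C1, g; split=> //; first exact/CC.
  by move=> D h /CC; apply: gE.
- move=> X; split=> [/CC/l[/SS SX ext0]|[/SS SX ext0]].
    by split=> // Y i /CC; apply: ext0.
  by apply/CC/l; split=> // Y i /CC; apply: ext0.
move=> X; split=> [/CC/r[/SS SX ext0]|[/SS SX ext0]].
  by split=> // Y i /CC; apply: ext0.
by apply/CC/r; split=> // Y i /CC; apply: ext0.
Qed.

(** * Short projective resolutions, and A as a tilting module *)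

Section ProjectiveResolution.
Variables (K P X : rmod A) (i : mor K P) (p : mor P X).
Hypotheses (sip : ses i p) (Kp : lift_proj K) (Pp : lift_proj P).

Definition short_mod (j : nat) : rmod A :=
  match j with 0 => P | 1 => K | _ => zero_mod A end.
Definition short_d (j : nat) : mor (short_mod j.+1) (short_mod j) :=
  match j with 0 => i | _ => 0 end.

Lemma zero_modP : is_zero (zero_mod A).
Proof. by move=> x; apply/rowP => -[]. Qed.

Fact short_proj j : projective (short_mod j).
Proof.
case: j => [|[|j]]; apply/projectiveP => //.
exact/lift_proj_zero/zero_modP.
Qed.
Fact short_exact0 : limg (mor_hom (short_d 0)) = lker (mor_hom p).
Proof. by have [_ _ ex] := sip; apply/exact_limg. Qed.
Fact short_exactS j : limg (mor_hom (short_d j.+1)) = lker (mor_hom (short_d j)).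
Proof.
apply/exact_limg; case: j => [|j] /=.
  split=> [x|y]; first by rewrite mor0E linear0.
  by have [ii _ _] := sip => /ii ->; exists 0; rewrite linear0.
by split=> [x|y _]; [rewrite !mor0E | exists 0; rewrite linear0 (zero_modP y)].
Qed.
Fact short_aug_surj : limg (mor_hom p) = fullv.
Proof. by have [_ ps _] := sip; apply/surj_limg. Qed.

Definition short_res : proj_res X :=
  @ProjRes _ _ X short_mod (mor_hom p) (fun j => mor_hom (short_d j)) short_proj
    (mor_is_hom p) (fun j => mor_is_hom (short_d j)) short_aug_surj short_exact0 short_exactS.

Lemma ses_pd_le1 : pd_le X 1.
Proof. by exists short_res => -[|[|j]] // _; apply: zero_modP. Qed.
End ProjectiveResolution.

Lemma projective_pd_lt P n : (0 < n)%N -> lift_proj P -> pd_lt P n.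
Proof.
move=> n0 Pp; have s0 : ses (0 : mor (zero_mod A) P) (idm P).
  split=> [x _|y|]; [exact: zero_modP | by exists y; rewrite idmE |].
  split=> [x|y]; first by rewrite mor0E linear0.
  by rewrite idmE => ->; exists 0; rewrite mor0E.
exists (short_res s0 (lift_proj_zero zero_modP) Pp) => -[|[|j]] nj; try exact: zero_modP.
by move: nj; rewrite leqNgt n0.
Qed.

Lemma tilting_regular : tilting L.
Proof.
exists 0; split; first exact/projective_pd_lt/lift_proj_regular.
  by move=> i; apply/ext_projective/lift_proj_regular.
pose M (i : nat) := if i is 0 then L else zero_mod A.
have M0 i : (0 < i)%N -> is_zero (M i) by case: i => // i _; apply: zero_modP.
have ex0 : exact (idm L) (0 : mor (M 0) (M 1)).
  by split=> [x|y _]; [rewrite mor0E | exists y; rewrite idmE].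
have exS i : exact (0 : mor (M i) (M i.+1)) (0 : mor (M i.+1) (M i.+2)).
  by split=> [x|y _]; [rewrite mor0E | exists 0; rewrite mor0E (zero_modP y)].
constructor; apply: (@Coresolution _ _ L 0 M (mor_hom (idm L)) (fun i => mor_hom 0)) => //.
- by case=> [|i] // _; apply/add1_projective/lift_proj_regular.
- exact: mor_is_hom.
- by move=> i; apply: mor_is_hom.
- by apply/inj_lker => x; rewrite idmE.
- exact/exact_limg.
by move=> i; apply/exact_limg.
Qed.

(** * Iterated translates and the tau-closure of DA *)

Section Iterates.
Variable m : nat.
Hypothesis gd : gldim_le A m.+1.
Local Notation n := m.+1.
Local Notation tau_iter i X := (iter i (@tau k A n) X).

(** Fullness lowers both exponents together until the source is DA, where [hom_injective_tau]
    applies. [S] is left open: it will be the iterates of DA in one direction and add c in the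
    other. *)
Lemma hom_tau_iter (S : subcat A) :
  (forall Z, S Z -> S (tau n Z)) -> S DL ->
  (forall Z, S Z -> forall i, (0 < i < n)%N -> Ext_vanishes i Z L) ->
  forall i j Y (g : mor (tau_iter i DL) (tau_iter j Y)), S Y -> (i < j)%N -> g = 0.
Proof.
move=> Stau SD Sext; have Siter j Y : S Y -> S (tau_iter j Y).
  by move=> SY; elim: j => //= j; apply: Stau.
elim=> [|i IH] [|j] Y g SY //= ij.
  have /isoP[u [v [uv vu]]] := iso_dualreg A.
  by rewrite -[g]compm1 -vu compmA (hom_injective_tau gd (g \m v)) comp0m.
have [f fg] := tau_rel_full gd g (Sext _ (Siter i DL SD)).
by apply: tau_rel_zero; rewrite -(IH _ _ f SY ij).
Qed.

Definition tau_image C : subcat A := fun Y => exists2 V, C V & Y = tau n V.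

(** For an identity this says that [tau] sends add C into the additive closure of the translates of
    [C]. *)
Lemma through_tau C X Y (f : mor X Y) g :
  through C f -> tau_rel (m := m) f g -> through (tau_image C) g.
Proof.
move=> Cf; elim: Cf g => [|Z p q f1 CZ _ IH] g fg.
  by rewrite (tau_rel_zero fg); apply: through0.
have [p' tp] := tau_rel_total m p; have [q' tq] := tau_rel_total m q.
have [g1 tg1] := tau_rel_total m f1.
rewrite (tau_rel_fun fg (tau_rel_add (tau_rel_comp tq tp) tg1)).
by apply: throughS; [exists Z | apply: IH].
Qed.

Lemma through_tau_iter C X i : through C (idm X) ->
  through (fun Y => exists2 V, C V & Y = tau_iter i V) (idm (tau_iter i X)).
Proof.
move=> CX; elim: i => [|i IH] /=; 
  first by apply: through_sub CX => Z CZ; apply: through_obj; exists Z.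
apply: through_sub (through_tau IH (tau_rel_id _ _)) => _ [_ [V CV ->] ->].
by apply: through_obj; exists V.
Qed.

Lemma tau_closureP X :
  tau_closure n X <-> through (fun Y => exists i, Y = tau_iter i DL) (idm X).
Proof. exact: addP. Qed.

Lemma tau_closure_iter i : tau_closure n (tau_iter i DL).
Proof. by apply/tau_closureP/through_obj; exists i. Qed.

Lemma tau_closure_add1 : tau_closure n L ->
  (forall X, tau_closure n X -> forall i, (0 < i < n)%N -> Ext_vanishes i X L) ->
  exists C : rmod A, subcat_eq (tau_closure n) (add1 C).
Proof.
move=> /tau_closureP ML Mext.
(* The identity of A is a finite sum of maps through iterates, so the exponents that occur are
   bounded. *)
have [N LN] : exists N : nat, through (fun Y => exists2 i, (i < N)%N & Y = tau_iter i DL) (idm L).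
  elim: ML => [|Z p q f [i Zi] _ [N FN]]; first by exists 0%N; apply: through0.
  exists (maxn i.+1 N); apply: throughS; first by exists i => //; rewrite leq_maxl.
  apply: through_sub FN => _ [j jN ->]; apply: through_obj; exists j => //.
  by rewrite leq_max jN orbT.
(* Precomposed with the factorised identity of A, a map from A to [tau_iter j DL] becomes a sum of
   maps through [tau_iter i DL] with i < N <= j, and these vanish. *)
have zero j : (N <= j)%N -> is_zero (tau_iter j DL).
  move=> Nj; apply: is_zero_hom => f; rewrite -[f]compm1.
  apply: (through_zero _ (through_compl f LN)) => _ [i iN ->] p.
  pose S (Z : rmod A) := exists i, Z = tau_iter i DL.
  apply: (@hom_tau_iter S _ _ _ i j DL) => //.
  - by move=> _ [l ->]; exists l.+1.
  - by exists 0%N.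
  - by move=> _ [l ->]; apply/Mext/tau_closure_iter.
  - by exists 0%N.
  exact: leq_trans iN Nj.
exists (\big[@dsum _ _/zero_mod A]_(i < N) tau_iter i DL) => X.
rewrite tau_closureP /add1 addP; split; apply: through_sub => Z.
  move=> [i ->]; have [Ni|iN] := leqP N i.
    by rewrite (proj1 (is_zero_idm _) (zero i Ni)); apply: through0.
  have [a [b ba]] := bigsum_retract (fun i : 'I_N => tau_iter i DL) (Ordinal iN).
  by rewrite -ba; apply: through1.
by move=> ->; apply: bigsum_through => i; exists i.
Qed.

(** * From a cluster tilting object to absolute completeness *)

Section ClusterTilting.
Variable c : rmod A.
Hypothesis c_ct : absolute_cluster_tilting n c.
Local Notation C := (add1 c).

Let C_ext X Y : C X -> C Y -> forall i, (0 < i < n)%N -> Ext_vanishes i X Y.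
Proof. by have [_ l _] := c_ct => /l[_ ext0] CY i; apply: ext0. Qed.

Let C_extl X : (forall Y, C Y -> forall i, (0 < i < n)%N -> Ext_vanishes i X Y) -> C X.
Proof. by have [_ l _] := c_ct => ext0; apply/l; split=> // Y i CY; apply: ext0. Qed.

Let C_extr X : (forall Y, C Y -> forall i, (0 < i < n)%N -> Ext_vanishes i Y X) -> C X.
Proof. by have [_ _ r] := c_ct => ext0; apply/r; split=> // Y i CY; apply: ext0. Qed.

Let C_proj P : lift_proj P -> C P.
Proof. by move=> Pp; apply: C_extl => Y _ i /andP[i0 _]; apply: ext_projective. Qed.

Let C_inj I : ext_inj I -> C I.
Proof. by move=> Ii; apply: C_extr => Y _ i /andP[i0 _]; apply: ext_injective. Qed.

Let C_reg : C L := C_proj (@lift_proj_regular _ A).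

Let C_tau Z : C Z -> C (tau n Z).
Proof.
move=> CZ; apply: C_extr => Y CY; apply: ext_to_tau => //; apply: C_ext => //.
Qed.

Let C_iter i Z : C Z -> C (tau_iter i Z).
Proof. by move=> CZ; elim: i => //= i; apply: C_tau. Qed.

Let C_through X : through C (idm X) -> C X.
Proof. by move=> CX; apply/addP; apply: through_sub CX => Z /addP. Qed.

Let C_id Y : C Y -> through (fun Z => Z = c) (idm Y).
Proof. by move/addP. Qed.

Let hom_zero i j Y (g : mor (tau_iter i DL) (tau_iter j Y)) : C Y -> (i < j)%N -> g = 0.
Proof.
apply: (@hom_tau_iter C) => //; first exact/C_inj/ext_inj_dualreg.
by move=> Z CZ; apply: C_ext.
Qed.

Let C_cover X : C X -> exists2 Z, C Z &
  through (fun Y => Y = DL \/ Y = tau n Z) (idm X).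
Proof.
move=> CX; have nuC : C (nu L) by apply/C_inj/nu_injective/lift_proj_regular.
have [Z [Zext [U [x1 [y1 [x2 [y2 [Up ->]]]]]]]] := ext_from_tau gd (C_ext nuC CX).
exists Z; first by apply: C_extl => Y CY; apply: Zext; apply: C_ext.
apply: throughS; first by right.
rewrite -[y2]compm1; apply/through_compr/through_compl.
apply: through_sub (through_nu_projective Up).
by move=> _ ->; apply: through_obj; left.
Qed.

(** The induction covers the remaining object [Y] and transports the result by the [j]-fold
    translate, so what is left over is always an iterate of an object of add c. *)
Let C_cover_iter X j : C X -> exists2 Y, C Y &
  through (fun V => (exists2 i, (i < j)%N & V = tau_iter i DL) \/ V = tau_iter j Y) (idm X).
Proof.
move=> CX; elim: j => [|j [Y CY FX]]; first by exists X => //; apply: through_obj; right.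
have [Z CZ FY] := C_cover CY; exists Z => //.
apply: through_sub FX => _ [[i ij ->]|->].
  by apply: through_obj; left; exists i => //; apply: ltnW.
apply: through_sub (through_tau_iter j FY) => _ [_ [->|->] ->].
  by apply: through_obj; left; exists j.
by rewrite -iterSr; apply: through_obj; right.
Qed.

(* Since tau is full, the dimensions of the End(tau^j c) decrease, and where two   *)
(* consecutive ones agree tau is faithful; it kills the maps that factor through A. *)
Let tau_faithful_step : exists j, forall (p : mor (tau_iter j c) L) (q : mor L (tau_iter j c)),
  q \m p = 0.
Proof.
have Cc j : C (tau_iter j c) by apply/C_iter/addP/through_obj.
have [j dj] := nat_seq_nondecreasing_step
  (fun j => \dim {: mor (tau_iter j c) (tau_iter j c)}).
exists j => p q.
have [||||_ faithful] := @lin_rel_dim k _ _ (@tau_rel _ _ m (tau_iter j c) (tau_iter j c)).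
- by move=> *; apply: tau_rel_lin.
- exact: tau_rel_total.
- exact: tau_rel_zero.
- by move=> w; apply: tau_rel_full => //; apply: C_ext.
apply: faithful => //.
have [p' tp] := tau_rel_total m p; have [q' tq] := tau_rel_total m q.
have q'0 : q' = 0.
  apply/morP => x; rewrite mor0E.
  by rewrite (tau_projective (@lift_proj_regular _ A) x) linear0.
by have := tau_rel_comp tp tq; rewrite q'0 comp0m.
Qed.

Let tau_nilpotent : exists j, is_zero (tau_iter j c).
Proof.
have [j qp0] := tau_faithful_step; exists j; apply: is_zero_hom => f.
have [Y CY FL] := C_cover_iter j C_reg.
suff fg0 (g : mor L L) : through (fun V => (exists2 i, (i < j)%N & V = tau_iter i DL) \/
    V = tau_iter j Y) g -> f \m g = 0 by rewrite -[f]compm1 fg0.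
elim=> [|Z p q f1 CZ _ IH]; first by rewrite compm0.
rewrite compmDr IH addr0 compmA; case: CZ => [[i ij ZE]|ZE]; subst Z.
  by rewrite (hom_zero (f \m p)) ?comp0m //; apply/addP/through_obj.
(* The identity of [tau_iter j Y] is a sum of maps through [tau_iter j c], so every term contains a
   composite tau^j c -> A -> tau^j c, which is zero by the choice of [j]. *)
rewrite -(compm1 (f \m p)) -!compmA.
have -> // : f \m (p \m (idm (tau_iter j Y) \m q)) = 0.
have := through_tau_iter j (C_id CY); elim=> [|Z a b g1 [V -> ZE] _ IH1].
  by rewrite comp0m !compm0.
subst Z; rewrite compmDl !compmDr IH1 addr0 -compmA !compmA.
by rewrite -(compmA f) qp0 !comp0m.
Qed.

Lemma cluster_tilting_tau_closure : subcat_eq (add1 c) (tau_closure n).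
Proof.
have [j cj0] := tau_nilpotent; move=> X; split=> [CX|]; last first.
  move=> /tau_closureP MX; apply: C_through; apply: through_sub MX => _ [i ->].
  by apply/through_obj/C_iter/C_inj/ext_inj_dualreg.
have [Y CY FX] := C_cover_iter j CX; apply/tau_closureP.
apply: through_sub FX => _ [[i _ ->]|->]; first by apply: through_obj; exists i.
suff -> : idm (tau_iter j Y) = 0 by apply: through0.
apply: (through_zero _ (through_tau_iter j (C_id CY))) => Z [V -> ->] p.
by rewrite -[p]compm1 (proj1 (is_zero_idm _) cj0) compm0.
Qed.

Lemma cluster_tilting_complete : absolutely_n_complete A n.
Proof.
have CM := cluster_tilting_tau_closure.
have PM_reg : subcat_eq (PM (A := A) n) (add1 L).
  move=> X; split=> [[/CM CX pdX]|/add1_projective Xp].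
    by apply/add1_projective/(pd_lt_projective pdX) => i; apply: C_ext.
  by split; [apply/CM/C_proj | apply: projective_pd_lt].
have perpL : subcat_eq (fun _ => True) (perp L).
  by move=> X; split=> // _ i; apply/ext_projective/lift_proj_regular.
split=> //; split=> //.
  exists L; split=> //; first exact: tilting_regular.
  exact: cluster_tilting_ext perpL CM c_ct.
by move=> X i [/CM CX _]; apply: C_ext.
Qed.
End ClusterTilting.

Lemma complete_cluster_tilting : absolutely_n_complete A n ->
  exists c : rmod A, absolute_cluster_tilting n c.
Proof.
move=> [[_ [T [_ PMT ct]] _] PML].
have Tp : lift_proj T.
  by apply/add1_projective/PML/PMT/addP/through_obj.
have perpT : subcat_eq (perp T) (fun _ => True).
  by move=> X; split=> // _ i; apply/ext_projective.
have ctM := cluster_tilting_ext perpT (fun X => conj id id) ct.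
have LM : tau_closure n L.
  by have [] : PM n L by apply/PML/add1_projective/lift_proj_regular.
(* A itself lies in the tau-closure, so the Ext vanishing between its objects covers Ext into A. *)
have [|C MC] := tau_closure_add1 LM.
  by move=> X MX i; have [_ l _] := ctM; have /l[_ ext0] := MX; apply: ext0.
by exists C; apply: cluster_tilting_ext MC ctM.
Qed.
End Iterates.

Lemma absolutely_complete_iff m : absolutely_n_complete A m.+1 <->
  gldim_le A m.+1 /\ exists c : rmod A, absolute_cluster_tilting m.+1 c.
Proof.
split=> [[[gd T ext0] P]|[gd [c c_ct]]]; last exact: cluster_tilting_complete c_ct.
by split=> //; apply: complete_cluster_tilting.
Qed.
End Completeness.

(** * Decomposition into indecomposables *)

Section KrullSchmidt.
Variables (k : fieldType) (A : falgType k).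
Implicit Types M N X Y Z P Q W K I S T U V : rmod A.
Implicit Types C : subcat A.
Local Notation "'L'" := (regular A).

Lemma inj_dim M N (f : mor M N) : inj f -> \dim (limg (mor_hom f)) = \dim {:M}.
Proof.
by move/inj_lker => f0; apply: limg_dim_eq; rewrite f0 capv0.
Qed.

Lemma endo_inj_iff_surj X (e : mor X X) : inj e <-> surj e.
Proof.
rewrite surj_limg; split=> [/inj_dim ed|es].
  by apply/eqP; rewrite eqEdim subvf ed /=.
apply/inj_lker/eqP; rewrite -dimv_eq0 -leqn0 -(leq_add2r (\dim {:X})).
by rewrite -{1}es -{1}[lker _]capfv limg_ker_dim.
Qed.

Lemma endo_inj_inverse X (e : mor X X) : inj e -> exists e', e' \m e = idm X /\ e \m e' = idm X.
Proof.
move=> ei; have es := proj1 (endo_inj_iff_surj e) ei.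
have [x|e' eE] := factor_inj (h := idm X) ei; first by have [y <-] := es x; exists y; rewrite idmE.
exists e'; split=> //; apply: (inj_cancel ei).
by rewrite compmA -eE comp1m compm1.
Qed.

Lemma indecomposable_retract X Y (i : mor X Y) (p : mor Y X) :
  indecomposable Y -> p \m i = idm X -> is_zero X \/ i \m p = idm Y.
Proof.
move=> [_ Yi] /retract_split[K [j [r [jr /Yi[X0|K0]]]]]; [by left | right].
move: jr; rewrite -[r]comp1m (proj1 (is_zero_idm _) K0) comp0m compm0.
by move/eqP; rewrite subr_eq0 => /eqP.
Qed.

(* Fitting's lemma, for the iterated squares of e. *)
Lemma indecomposable_local X (e : mor X X) :
  indecomposable X -> inj e \/ inj (idm X - e).
Proof.
move=> Xi; pose sq := fix sq j := if j is j'.+1 then sq j' \m sq j' else e.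
have [j] := nat_seq_nondecreasing_step (fun j => \dim (limg (mor_hom (sq j)))).
rewrite /=; set g := sq j => dj.
(* [g] and its square have the same image, so [g] restricts to the bijection [p \m i] of its image
   [I], and [I] is a direct summand of [X]. If [I] is zero, then so is [g], while [g] fixes what [e]
   fixes; otherwise [g] is injective, and with it [e]. *)
have im2 : limg (mor_hom (g \m g)) = limg (mor_hom g).
  by apply/eqP; rewrite eqEdim dj andbT [X in (X <= _)%VS]limg_comp limgS ?subvf.
have [I [p [i [ps ii gE]]]] := image_exists g.
have pis : surj (p \m i).
  move=> z; have [x <-] := ps z.
  have : g x \in limg (mor_hom (g \m g)) by rewrite im2 memv_img ?memvf.
  move/memv_imgP => [y _ xE]; exists (p y); apply: (inj_injective ii).
  have -> : i (p x) = (g \m g) y by rewrite -compmE -gE.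
  by rewrite gE !compmE.
have pii := proj2 (endo_inj_iff_surj _) pis.
have [r [rpi pir]] := endo_inj_inverse pii.
have [|I0|irp] := @indecomposable_retract I X i (r \m p) Xi; first by rewrite -compmA.
  right=> x; rewrite morBE idmE => /eqP; rewrite subr_eq0 => /eqP xe.
  have gx : g x = x by rewrite /g; elim: (j) => [|l IH] /=; rewrite ?compmE ?IH.
  by rewrite -gx gE compmE (I0 (p x)) linear0.
have gi : inj g.
  move=> x; rewrite gE compmE => /ii px.
  by rewrite -[x]idmE -irp !compmE px !linear0.
left; rewrite -[e]/(sq 0%N); move: gi; rewrite /g; elim: (j) => // l IH sqi.
by apply: IH => x sx; apply: sqi; rewrite /= compmE sx linear0.
Qed.

(** The endomorphism ring of [X] is local, so an invertible finite sum has an invertible summand. *)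
Lemma through_indecomposable C X (f : mor X X) :
  indecomposable X -> inj f -> through C f ->
  exists Z (p : mor Z X) (q : mor X Z), C Z /\ inj (p \m q).
Proof.
move=> Xi + Cf; elim: Cf => [f0|Z p q f1 CZ _ IH fi].
  by case: (Xi) => -[] x; apply: f0; rewrite mor0E.
have [f' [f'f _]] := endo_inj_inverse fi.
have [ei|ei] := indecomposable_local (f' \m (p \m q)) Xi.
  exists Z, p, q; split=> // x px; apply: ei; rewrite compmE px linear0.
  by [].
apply: IH => x f1x; apply: ei.
by rewrite -f'f compmDr addrC addKr compmE f1x linear0.
Qed.

Lemma indecomposable_iso C X : (forall Z, C Z -> indecomposable Z) ->
  indecomposable X -> through C (idm X) -> exists2 Z, C Z & iso X Z.
Proof.
move=> Ci Xi; case/(through_indecomposable Xi) => [x|Z [p [q [CZ pqi]]]].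
  by rewrite idmE.
have [u [upq _]] := endo_inj_inverse pqi; rewrite compmA in upq.
have [X0|qup] := indecomposable_retract (Ci Z CZ) upq; first by case: (Xi).
by exists Z => //; apply: iso_of_mor qup upq.
Qed.

Lemma through_indecomposables X : through (@indecomposable k A) (idm X).
Proof.
have [d] := ubnP (\dim {:X}); elim: d X => // d IH X; rewrite ltnS => Xd.
have [X0|Xn0] := classic (is_zero X); first by rewrite (proj1 (is_zero_idm _) X0); apply: through0.
have [Xi|Xni] := classic (indecomposable X); first exact: through_obj.
have [[Y Z] /= [XYZ [Y0 Z0]]] : exists YZ : rmod A * rmod A,
    iso X (dsum YZ.1 YZ.2) /\ ~ is_zero YZ.1 /\ ~ is_zero YZ.2.
  apply: NNPP => nYZ; apply: Xni; split=> // Y Z XYZ.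
  have [Y0|Y0] := classic (is_zero Y); [by left | right].
  by apply: NNPP => Z0; apply: nYZ; exists (Y, Z).
have dim_gt0 V : ~ is_zero V -> (0 < \dim {:V})%N.
  move=> V0; rewrite lt0n; apply/negP; rewrite dimv_eq0 => /eqP Ve; apply: V0 => x.
  by apply/eqP; rewrite -memv0 -Ve memvf.
have dE : \dim {:X} = (\dim {:Y} + \dim {:Z})%N.
  have [f [g [fg gf]]] := proj1 (isoP _ _) XYZ.
  have -> : (\dim {:Y} + \dim {:Z})%N = \dim {:dsum Y Z} by rewrite !dimvf.
  rewrite -(inj_dim (f := f)) => [|x fx].
    by congr (\dim _); apply/surj_limg => y; exists (g y); rewrite -compmE fg idmE.
  by rewrite -[x]idmE -gf compmE fx linear0.
have part V (a : mor V (dsum Y Z)) (b : mor X V) :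
    (\dim {:V} < \dim {:X})%N -> through (@indecomposable k A) (a \m b).
  by move=> VX; rewrite -[b]comp1m; apply/through_compl/through_compr/IH/(leq_trans VX).
have [f [g [fg gf]]] := proj1 (isoP _ _) XYZ.
rewrite -gf -[g]compm1 dsum_idm -compmA; apply: through_compl; rewrite compmDl -!compmA.
apply: throughD; apply: part; rewrite dE.
  by rewrite -[X in (X < _)%N]addn0 ltn_add2l dim_gt0.
by rewrite -[X in (X < _)%N]add0n ltn_add2r dim_gt0.
Qed.
End KrullSchmidt.

(** * The case n = 1 *)

Section Hereditary.
Variables (k : fieldType) (A : falgType k).
Implicit Types M N X Y Z P Q W K I S T U V : rmod A.
Implicit Types C : subcat A.
Local Notation "'L'" := (regular A).

(** The first coordinate maps [W] onto a right ideal, which is projective; so [W] splits into that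
    ideal and a kernel that embeds in the free module of rank one less. *)
Lemma hereditary_free_sub m W (u : mor W (free_mod A m)) :
  hereditary A -> inj u -> lift_proj W.
Proof.
move=> her; elim: m W u => [|m IH] W u ui.
  by apply: lift_proj_zero => x; apply: ui; apply/ffunP => -[].
have hL : linear ((fun x => x ord0) : free_mod A m.+1 -> L) by move=> c x y; rewrite !ffunE.
have hA (x : free_mod A m.+1) a : (ract x a : {ffun _ -> A}) ord0 = ract (x ord0 : L) a.
  by rewrite ffunE.
pose tl (x : free_mod A m.+1) : free_mod A m := [ffun i => x (lift ord0 i)].
have tL : linear tl by move=> c x y; apply/ffunP => i; rewrite !ffunE.
have tA x a : tl (ract x a) = ract (tl x) a by apply/ffunP => i; rewrite !ffunE.
pose t := mk_mor hL hA \m u.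
have stI := limg_stable (mor_is_hom t).
have [i [ii iE]] := sub_mor_exists stI.
have [x|p tE] := factor_inj (h := t) ii; first by apply/iE; rewrite memv_img ?memvf.
have ps : surj p.
  move=> y; have /iE/memv_imgP[x _ xE] : exists z, i z = i y by exists y.
  by exists x; apply: (inj_injective ii); rewrite -compmE -tE.
have Ip : lift_proj (submod stI) by apply/projectiveP/her.
have [s ps1] := split_epi_proj Ip ps; have [K [j [ji [pj jp]]]] := ker_exists p.
have Kp : lift_proj K.
  apply: (IH K (mk_mor tL tA \m u \m j)) => y; rewrite !compmE mk_morE => ty.
  apply/ji/ui/ffunP => l; rewrite [RHS]ffunE; case: (unliftP ord0 l) => [l'|] ->.
    by have /ffunP/(_ l') := ty; rewrite !ffunE.
  have <- : t (j y) = (u (j y) : {ffun _ -> A}) ord0 by rewrite compmE mk_morE.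
  by rewrite tE compmE pj linear0.
have [|r rE] := factor_ker (f := idm W - s \m p) ji (conj pj jp).
  by rewrite compmBr compmA ps1 comp1m compm1 subrr.
apply: (@lift_proj_through _ _ (@lift_proj _ A)) => //.
have -> : idm W = s \m p + j \m r by rewrite -rE addrC subrK.
by apply: throughD; apply: through1.
Qed.

Lemma hereditary_iff : hereditary A <-> gldim_le A 1.
Proof.
split=> [her X|gd I stI].
  apply: (ses_pd_le1 (ses_fcover X)); last exact: lift_proj_free.
  by have [ki _ _] := ses_fcover X; apply: hereditary_free_sub ki.
(* A right ideal is a first syzygy of the quotient of A by it. *)
have [i [ii iE]] := sub_mor_exists stI; have [Q [p [ps pE]]] := quot_exists stI.
apply/projectiveP/(@gldim_syz _ _ 1 Q) => //.
exists Q, L, i, p; split=> //; first exact: lift_proj_regular.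
by split=> //; split=> [x|y /pE/iE //]; apply/pE/iE; exists x.
Qed.

Lemma cluster_tilting1 C : (forall X, C X) -> cluster_tilting 1 (fun _ => True) C.
Proof.
move=> CX; split=> [X _|X|X]; last 2 first.
- by split=> // _; split=> // Y [].
- by split=> // _; split=> // Y [].
have idh : is_hom (\1%VF : 'End(X)) by move=> x a; rewrite !id_lfunE.
split; exists X, \1%VF; split=> // Y h _ hh; exists h => //.
  by rewrite comp_lfun1l.
by rewrite comp_lfun1r.
Qed.

Lemma representation_finite_iff :
  representation_finite A <-> exists c : rmod A, absolute_cluster_tilting 1 c.
Proof.
split=> [[m [F FP]]|[c [_ cP _]]].
  pose c := \big[@dsum _ _/zero_mod A]_(i < m) F i.
  exists c; apply: cluster_tilting1 => X; apply/addP.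
  apply: through_sub (through_indecomposables X) => Z /FP[i /isoP[f [g [_ gf]]]].
  have [a [b ba]] := bigsum_retract F i.
  by rewrite -gf -[g]compm1 -ba compmA -compmA; apply: through1.
have cX X : through (fun Z => Z = c) (idm X).
  by apply/addP/cP; split=> // Y [].
have [m [F [Fi [u [v vu]]]]] := through_bigsum (through_indecomposables c).
exists m, F => X Xi.
have XF : through (fun Z => exists i, Z = F i) (idm X).
  apply: through_sub (cX X) => _ ->; rewrite vu -[v]compm1.
  by apply/through_compr/through_compl/bigsum_through => i; exists i.
have [|_ [i ->] Xiso] := indecomposable_iso _ Xi XF; first by move=> _ [i ->].
by exists i.
Qed.

Lemma complete1_absolutely : n_complete A 1 -> absolutely_n_complete A 1.
Proof.
move=> c1; split=> //; have [_ [T [_ PMT [_ ctl _]]] _] := c1.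
have Tp : lift_proj T.
  have [_ pdT] : PM 1 T by apply/PMT/addP/through_obj.
  by apply: (pd_lt_projective pdT) => -[|[]].
(* [T] is projective and no degree satisfies 0 < i < 1, so every module meets both conditions that
   describe the tau-closure. *)
have MX X : tau_closure 1 X.
  by apply/ctl; split=> [i|Y []] //; apply: ext_projective.
move=> X; split=> [[_ pdX]|/add1_projective Xp].
  by apply/add1_projective/(pd_lt_projective pdX) => -[|[]].
by split=> //; apply: projective_pd_lt.
Qed.
End Hereditary.

Theorem proposition1p13 :
  (forall (k : fieldType) (A : falgType k),
     n_complete A 1 <-> representation_finite A /\ hereditary A)
  /\
  (forall (k : fieldType) (n : nat) (A : falgType k), (1 <= n)%N ->
     (absolutely_n_complete A n <->
      gldim_le A n /\ exists C : rmod A, absolute_cluster_tilting n C)).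
Proof.
split=> k => [A|[//|m] A _]; last exact: absolutely_complete_iff.
rewrite hereditary_iff representation_finite_iff; split=> [/complete1_absolutely|[fin gd]].
  by case/absolutely_complete_iff.
by have [] := proj2 (absolutely_complete_iff A 0) (conj gd fin).
Qed.
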